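(* Let $G$ be a finite group and $\omega\in Z^3(G,\mathbb{T})$. Then there exists an AF-$(G,\omega)$ action with the Rokhlin property on $M_{|G|^\infty}$.
   Context: $M_{|G|^\infty}=\bigotimes_{i\in\mathbb{N}}M_{|G|}$ is the UHF algebra of type $|G|^\infty$. Anomalous actions. $M(A)$ is the multiplier algebra of $A$, $U(M(A))$ its unitary group, automorphisms of $A$ are extended to $M(A)$, and $\mathrm{Ad}(w)(a)=waw^*$. An anomalous action of a countable discrete group $G$ on $A$ is a pair $(\alpha,u)$ of maps $\alpha:G\to\mathrm{Aut}(A)$, $u:G\times G\to U(M(A))$ with $\alpha_g\alpha_h=\mathrm{Ad}(u_{g,h})\alpha_{gh}$ and $\alpha_g(u_{h,k})u_{g,hk}u_{gh,k}^*u_{g,h}^*\in\mathbb{T}\cdot 1_{M(A)}$ for all $g,h,k\in G$. The scalars in the last expression form a 3-cocycle $o(\alpha,u)\in Z^3(G,\mathbb{T})$ (trivial action on $\mathbb{T}$), called the anomaly; $(\alpha,u)$ is a $(G,\omega)$ action if $o(\alpha,u)=\omega$. Rokhlin property. $A_\infty$ is the C$^*$-algebra of bounded sequences in $A$ modulo sequences converging to $0$ in norm; $A$ embeds as constant sequences. $F(A)=(A_\infty\cap A')/(A_\infty\cap A^\perp)$, where $A_\infty\cap A'$ is the set of $x\in A_\infty$ commuting with $A$ and $A_\infty\cap A^\perp=\{x\in A_\infty: xA=Ax=0\}$ (which is $0$ for unital $A$). This is unital if $A$ is $\sigma$-unital, and $\alpha$ induces (entrywise) a genuine group action, still denoted $\alpha$,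 on $F(A)$. For $G$ finite and $A$ $\sigma$-unital, $(\alpha,u)$ has the Rokhlin property if there are projections $p_g\in F(A)$, $g\in G$, with $\sum_{g}p_g=1$ and $\alpha_g(p_h)=p_{gh}$ for all $g,h\in G$. AF-actions. For unitaries $s_g\in U(M(A))$, set $\alpha^s_g=\mathrm{Ad}(s_g)\alpha_g$ and $u^s_{g,h}=s_g\alpha_g(s_h)u_{g,h}s_{gh}^*$; $(\alpha,u)$ on $A$ and $(\beta,v)$ on $B$ are cocycle conjugate if there are an isomorphism $\theta:A\to B$ and unitaries $s_g\in U(M(A))$ with $\theta\alpha^s_g\theta^{-1}=\beta_g$ and $\theta(u^s_{g,h})=v_{g,h}$. A $(G,\omega)$ action on a unital AF-algebra $A$ is called an AF-action if it is cocycle conjugate to an inductive limit action $\varinjlim(A_n,\theta_n,u_n)$, where each $A_n$ is a finite-dimensional C$^*$-algebra, $(\theta_n,u_n)$ is a $(G,\omega)$ action on $A_n$, and the connecting maps are unital $^*$-homomorphisms $\varphi_n:A_n\to A_{n+1}$ with $\varphi_n\theta_n(g)=\theta_{n+1}(g)\varphi_n$ and $\varphi_n(u_n(g,h))=u_{n+1}(g,h)$ for all $g,h\in G$. *)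

(* Defs.v *)
From HB Require Import structures.
From mathcomp Require Import all_boot all_order all_algebra all_fingroup.
From mathcomp Require Import complex.
From mathcomp Require Import all_classical all_reals all_analysis.

Set Implicit Arguments.
Unset Strict Implicit.
Unset Printing Implicit Defensive.

Import Order.TTheory GRing.Theory Num.Theory.
Import numFieldNormedType.Exports.

Local Open Scope classical_set_scope.
Local Open Scope ring_scope.

(* Unital C*-algebras. As the carrier is an algType, 1 != 0. Completeness is
   stated by hand: Hierarchy-Builder admits no join of the normed-module and
   algebra hierarchies besides numDomainType. *)
HB.mixin Record isCstar (R : realType) A of GRing.Algebra R[i] A := {
  cnorm : A -> R;
  star : A -> A;
  cnorm_eq0 : forall x : A, cnorm x = 0 -> x = 0;
  cnormD : forall x y : A, cnorm (x + y) <= cnorm x + cnorm y;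
  cnormZ : forall (a : R[i]) (x : A),
    (cnorm (a *: x))%:C%C = `|a| * (cnorm x)%:C%C;
  cnormM : forall x y : A, cnorm (x * y) <= cnorm x * cnorm y;
  cnorm_complete : forall x : nat -> A,
    (forall e : R, 0 < e -> exists N : nat, forall m n : nat,
       (N <= m)%N -> (N <= n)%N -> cnorm (x m - x n) < e) ->
    exists l : A, cnorm (x n - l) @[n --> \oo] --> (0 : R);
  starK : involutive star;
  starD : {morph star : x y / x + y};
  starZ : forall (a : R[i]) (x : A), star (a *: x) = a^* *: star x;
  starM : forall x y : A, star (x * y) = star y * star x;
  cnorm_star : forall x : A, cnorm (star x * x) = cnorm x ^+ 2
}.

#[short(type="cstarType")]
HB.structure Definition Cstar (R : realType) :=
  {A of isCstar R A & GRing.Algebra R[i] A}.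

Section Morphisms.
Variable R : realType.

Record star_hom (A B : cstarType R) (f : A -> B) : Prop := {
  star_hom_linear : linear f;
  star_homM : {morph f : x y / x * y};
  star_hom1 : f 1 = 1;
  star_hom_star : {morph f : x / star x}
}.

Definition star_iso (A B : cstarType R) (f : A -> B) : Prop :=
  star_hom f /\ bijective f.

Definition null_seq (A : cstarType R) (x : nat -> A) : Prop :=
  cnorm (x n) @[n --> \oo] --> (0 : R).

Definition norm_closed (A : cstarType R) (S : set A) : Prop :=
  forall (x : nat -> A) (l : A),
    (forall n, S (x n)) -> null_seq (fun n => x n - l) -> S l.

Definition unitary (A : cstarType R) (w : A) : Prop :=
  star w * w = 1 /\ w * star w = 1.

Definition Ad (A : cstarType R) (w : A) (a : A) : A := w * a * star w.

Definition finite_dimensional (A : cstarType R) : Prop :=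
  exists (d : nat) (e : 'I_d -> A),
    forall x : A, exists c : 'I_d -> R[i], x = \sum_(i < d) c i *: e i.

Record star_subalgebra (A : cstarType R) (S : set A) : Prop := {
  star_subalgebra1 : S 1;
  star_subalgebraP : forall (a : R[i]) (x y : A), S x -> S y -> S (a *: x + y);
  star_subalgebraM : forall x y : A, S x -> S y -> S (x * y);
  star_subalgebra_star : forall x : A, S x -> S (star x)
}.

End Morphisms.

Section InfiniteTensorPower.
Variable R : realType.

(* Unital *-homomorphisms M_n(C) -> A; the involution of M_n(C) is the
   conjugate transpose. *)
Record matrix_star_hom (n : nat) (A : cstarType R) (j : 'M[R[i]]_n -> A) : Prop := {
  matrix_star_hom_linear : linear j;
  matrix_star_homM : {morph j : X Y / X *m Y >-> X * Y};
  matrix_star_hom1 : j 1%:M = 1;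
  matrix_star_hom_star :
    forall X : 'M[R[i]]_n, j (map_mx Num.conj X^T) = star (j X)
}.

(* A is the infinite tensor product of copies of M_n indexed by nat, j i being
   the embedding of the i-th tensor factor: the factors commute and together
   generate A as a C*-algebra. Since the finite tensor powers of M_n are simple,
   the norm on the algebraic tensor product is unique, so these conditions
   determine A up to isomorphism. *)
Record infinite_tensor_power (n : nat) (A : cstarType R)
    (j : nat -> 'M[R[i]]_n -> A) : Prop := {
  tensor_factor : forall i, matrix_star_hom (j i);
  tensor_factorC : forall (i k : nat) (X Y : 'M[R[i]]_n),
    i <> k -> j i X * j k Y = j k Y * j i X;
  tensor_generate : forall S : set A,
    norm_closed S -> star_subalgebra S -> (forall i X, S (j i X)) -> S = setT
}.

Definition is_UHF_infty (n : nat) (A : cstarType R) : Prop :=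
  exists j : nat -> 'M[R[i]]_n -> A, infinite_tensor_power j.

End InfiniteTensorPower.

Section AnomalousActions.
Variables (R : realType) (G : groupType).

Definition cocycle3 (omega : G -> G -> G -> R[i]) : Prop :=
  (forall g h k, `|omega g h k| = 1) /\
  (forall g h k l,
     omega h k l * omega g (h * k)%g l * omega g h k =
     omega (g * h)%g k l * omega g h (k * l)%g).

(* All algebras are unital, so that M(A) = A. *)
Definition anomaly_element (A : cstarType R) (alpha : G -> A -> A)
    (u : G -> G -> A) (g h k : G) : A :=
  alpha g (u h k) * u g (h * k)%g * star (u (g * h)%g k) * star (u g h).

Record anomalous_action (A : cstarType R) (alpha : G -> A -> A)
    (u : G -> G -> A) : Prop := {
  anomalous_aut : forall g, star_iso (alpha g);
  anomalous_unitary : forall g h, unitary (u g h);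
  anomalous_comp : forall g h x,
    alpha g (alpha h x) = Ad (u g h) (alpha (g * h)%g x);
  anomalous_scalar : forall g h k,
    exists z : R[i], `|z| = 1 /\ anomaly_element alpha u g h k = z *: 1
}.

Definition omega_action (omega : G -> G -> G -> R[i]) (A : cstarType R)
    (alpha : G -> A -> A) (u : G -> G -> A) : Prop :=
  anomalous_action alpha u /\
  forall g h k, anomaly_element alpha u g h k = omega g h k *: 1.

Definition cocycle_conjugate
    (A : cstarType R) (alpha : G -> A -> A) (u : G -> G -> A)
    (B : cstarType R) (beta : G -> B -> B) (v : G -> G -> B) : Prop :=
  exists (theta : A -> B) (s : G -> A),
    [/\ star_iso theta,
        forall g, unitary (s g),
        forall g x, theta (Ad (s g) (alpha g x)) = beta g (theta x) &
        forall g h,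
          theta (s g * alpha g (s h) * u g h * star (s (g * h)%g)) = v g h].

(* (B, mu) is the inductive limit of (A_n, phi_n), by its universal property. *)
Record inductive_limit (A : nat -> cstarType R)
    (phi : forall n, A n -> A n.+1)
    (B : cstarType R) (mu : forall n, A n -> B) : Prop := {
  limit_hom : forall n, star_hom (@mu n);
  limit_compat : forall n x, mu n.+1 (phi n x) = mu n x;
  limit_universal : forall (D : cstarType R) (psi : forall n, A n -> D),
    (forall n, star_hom (psi n)) ->
    (forall n x, psi n.+1 (phi n x) = psi n x) ->
    exists! f : B -> D, star_hom f /\ (forall n x, f (mu n x) = psi n x)
}.

(* (beta, v) is the inductive limit of omega-actions (theta_n, u_n) on
   finite-dimensional algebras. *)
Record AF_limit_action (omega : G -> G -> G -> R[i])
    (A : nat -> cstarType R)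
    (theta : forall n, G -> A n -> A n) (u : forall n, G -> G -> A n)
    (phi : forall n, A n -> A n.+1)
    (B : cstarType R) (mu : forall n, A n -> B)
    (beta : G -> B -> B) (v : G -> G -> B) : Prop := {
  AF_fin_dim : forall n, finite_dimensional (A n);
  AF_level_action : forall n, omega_action omega (@theta n) (@u n);
  AF_connecting : forall n, star_hom (@phi n);
  AF_connecting_act : forall n g x,
    phi n (theta n g x) = theta n.+1 g (phi n x);
  AF_connecting_cocycle : forall n g h, phi n (u n g h) = u n.+1 g h;
  AF_limit : inductive_limit phi mu;
  AF_limit_omega : omega_action omega beta v;
  AF_limit_act : forall n g x, beta g (mu n x) = mu n (theta n g x);
  AF_limit_cocycle : forall n g h, v g h = mu n (u n g h)
}.

Definition AF_action (omega : G -> G -> G -> R[i]) (A : cstarType R)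
    (alpha : G -> A -> A) (u : G -> G -> A) : Prop :=
  omega_action omega alpha u /\
  exists (An : nat -> cstarType R)
         (theta : forall n, G -> An n -> An n) (un : forall n, G -> G -> An n)
         (phi : forall n, An n -> An n.+1)
         (B : cstarType R) (mu : forall n, An n -> B)
         (beta : G -> B -> B) (v : G -> G -> B),
    AF_limit_action omega theta un phi mu beta v /\
    cocycle_conjugate alpha u beta v.

End AnomalousActions.

(* The central sequence algebra F(A) = (A_oo :&: A') / (A_oo :&: A^perp) is
   handled through representatives: its elements are given by bounded sequences
   satisfying [central_seq], and two of them are equal in F(A) when they are
   related by [F_eq]; the operations are entrywise. *)
Section Rokhlin.
Variables (R : realType) (A : cstarType R).

Definition central_seq (x : nat -> A) : Prop :=
  (exists M : R, forall n, cnorm (x n) <= M) /\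
  (forall a : A, null_seq (fun n => x n * a - a * x n)).

Definition F_eq (x y : nat -> A) : Prop :=
  forall a : A, null_seq (fun n => (x n - y n) * a) /\
                null_seq (fun n => a * (x n - y n)).

Definition Rokhlin_property (G : finGroupType) (alpha : G -> A -> A) : Prop :=
  exists p : G -> nat -> A,
    [/\ forall g, central_seq (p g),
        forall g, F_eq (fun n => p g n * p g n) (p g) /\
                  F_eq (fun n => star (p g n)) (p g),
        F_eq (fun n => \sum_(g : G) p g n) (fun=> 1) &
        forall g h, F_eq (fun n => alpha g (p h n)) (p (g * h)%g)].

End Rokhlin.

(* Main.v *)
Require Import Defs.
From HB Require Import structures.
From mathcomp Require Import all_boot all_order all_algebra all_fingroup.
From mathcomp Require Import complex finmap.
From mathcomp Require Import all_classical all_reals all_analysis summability.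
From mathcomp Require Import ring lra.

Set Implicit Arguments.
Unset Strict Implicit.
Unset Printing Implicit Defensive.

Import Order.TTheory GRing.Theory Num.Theory.
Import numFieldNormedType.Exports.

Local Open Scope classical_set_scope.
Local Open Scope ring_scope.

(** Consider the fusion category whose simple objects are
    the elements of [G], with associator [omega], and let [X] be the sum of all
    simple objects. The algebras [End (X ^ n)] are finite-dimensional, tensoring
    with the identity of [X] on the right includes each of them into the next one,
    and tensoring on the left with [g], followed by an isomorphism of the tensor
    product of [g] and [X] with [X], defines automorphisms of them. These compose
    like the elements of [G] up to unitaries of [End X], with an anomaly given by
    the pentagon equation, that is, by [omega].

    In coordinates, [X ^ (n + 1)] has a basis of words of length [n + 1] in the
    letters of [G], the letters being the partial products of the degrees of the
    factors. With this choice [End (X ^ (n + 1))] becomes the tensor product of [n]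
    full matrix algebras and of the diagonal matrices in the last letter ([level
    n]), and the inclusions become the standard ones, so that the union is dense in
    the UHF algebra. The automorphism attached to [g] is conjugation by a unitary
    ([implementer n g]): it translates all letters by [g] and multiplies the word
    [x_0 ... x_n] by the phases [omega g x_i (x_i^-1 * x_i+1)]. By the cocycle
    identity, the phases of a product of two such unitaries telescope
    ([implementerM]). What is left at the last letter commutes with [level n]; what
    is left at the first one is the cocycle of the action ([action_cocycle]), whose
    anomaly is [omega] by the cocycle identity again ([limit_action_anomaly]). On
    each [level n] the conjugations are eventually constant, so they converge on the
    whole UHF algebra, to an action that restricts to all levels ([limit_action],
    [limit_AF_action]). Since letters are translated, the minimal diagonal
    projections of the [n]-th factor are permuted by the action as the Rokhlin
    property requires, and they commute with more and more of the algebra as [n]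
    grows ([limit_action_Rokhlin]).

    Two facts of analysis enter. The UHF algebra exists because its tensor factors
    act on the Hilbert space with a basis indexed by infinite words ([UHF_exists]);
    the bounded operators there form a C*-algebra. And the union of the levels has
    the universal property of an inductive limit because *-homomorphisms are
    continuous ([star_hom_bounded]): a small self-adjoint element [h] is the real
    part of the unitary [h + i sqrt (1 - h ^ 2)], and unitaries are mapped to
    unitaries. *)

(** * Complex numbers and C*-norms *)

Section ComplexNumbers.
Variable R : realType.
Implicit Types z w : R[i].

Local Notation normc := ComplexField.Normc.normc.

Lemma norm_complexE z : `|z| = (normc z)%:C%C.
Proof. by []. Qed.

Lemma normc_ge0 z : 0 <= normc z.
Proof. by rewrite -ler0c -norm_complexE. Qed.

Lemma mul_conjC_unit z : `|z| = 1 -> z^* * z = 1.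
Proof. by move=> h; rewrite mulrC -normCK h expr1n. Qed.

Lemma Re_le_normc z : `|complex.Re z| <= normc z.
Proof. by rewrite -lecR; exact: normc_ge_Re. Qed.

Lemma Im_le_normc z : `|complex.Im z| <= normc z.
Proof.
case: z => a b; rewrite /normc /=.
rewrite -(ler_pXn2r (ltn0Sn 1)) ?nnegrE ?sqrtr_ge0// sqr_sqrtr ?addr_ge0 ?sqr_ge0//.
by rewrite real_normK ?num_real// lerDr sqr_ge0.
Qed.

Lemma normc_le_ReIm z : normc z <= `|complex.Re z| + `|complex.Im z|.
Proof.
case: z => a b; rewrite /normc /=.
rewrite -(ler_pXn2r (ltn0Sn 1)) ?nnegrE ?addr_ge0 ?sqrtr_ge0//.
rewrite sqr_sqrtr ?addr_ge0 ?sqr_ge0// sqrrD !real_normK ?num_real//.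
by rewrite lerD2r lerDl mulrn_wge0 ?mulr_ge0.
Qed.

Lemma complex_complete (z : nat -> R[i]) :
  (forall e : R, 0 < e -> exists N : nat, forall m n : nat,
     (N <= m)%N -> (N <= n)%N -> normc (z m - z n) < e) ->
  exists l, normc (z n - l) @[n --> \oo] --> (0 : R).
Proof.

move=> cz.
(* Applied to the real and to the imaginary part. *)
have part (f : R[i] -> R) : (forall z w, f (z - w) = f z - f w) ->
    (forall z, `|f z| <= normc z) -> exists l : R, f (z n) @[n --> \oo] --> l.
  move=> fB fle; have cf : cauchy (f (z n) @[n --> \oo]).
    apply: cauchy_exP => e e0; have [N hN] := cz e e0.
    exists (f (z N)); exists N => // n /= Nn.
    rewrite /ball /= -fB; apply: le_lt_trans (fle _) _; exact: hN.
  have h : cvg (f (z n) @[n --> \oo]) by exact: cauchy_cvg.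
  by exists (lim (f (z n) @[n --> \oo])).
have [|a ha] := part _ _ Re_le_normc; first by case=> ? ? [].
have [|b hb] := part _ _ Im_le_normc; first by case=> ? ? [].
exists (Complex a b).
have dist (f : nat -> R) l : f n @[n --> \oo] --> l -> `|f n - l| @[n --> \oo] --> (0 : R).
  by move=> h; rewrite -(normr0 R) -(subrr l); apply: cvg_norm; apply: cvgB => //; exact: cvg_cst.
apply: (@squeeze_cvgr _ _ _ _ (fun=> 0)
  (fun n => `|complex.Re (z n) - a| + `|complex.Im (z n) - b|)).
- near=> n; rewrite normc_ge0 /=.
  by case: (z n) => x y; apply: le_trans (normc_le_ReIm _) _.
- exact: cvg_cst.
- by rewrite -[X in _ --> X](addr0 0); apply: cvgD; exact: dist.
Unshelve. all: by end_near. Qed.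

End ComplexNumbers.

Local Notation normc := ComplexField.Normc.normc.

Section CstarNorm.
Variables (R : realType) (A : cstarType R).
Implicit Types (x y z w : A) (a : R[i]).

Lemma cnormZr a x : cnorm (a *: x) = normc a * cnorm x.
Proof. by apply: complexI; rewrite cnormZ norm_complexE -rmorphM. Qed.

Lemma cnorm0 : cnorm (0 : A) = 0.
Proof. by rewrite -(scale0r 0) cnormZr ComplexField.Normc.normc0 mul0r. Qed.

Lemma cnormN x : cnorm (- x) = cnorm x.
Proof. by rewrite -scaleN1r cnormZr normcN ComplexField.Normc.normc1 mul1r. Qed.

Lemma cnormB x y : cnorm (x - y) <= cnorm x + cnorm y.
Proof. by rewrite -(cnormN y) cnormD. Qed.

Lemma cdistC x y : cnorm (x - y) = cnorm (y - x).
Proof. by rewrite -cnormN opprB. Qed.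

Lemma cnorm_ge0 x : 0 <= cnorm x.
Proof.
by have := cnormB x x; rewrite subrr cnorm0 -mulr2n pmulrn_lge0.
Qed.
Hint Resolve cnorm_ge0 : core.

Lemma star0 : star (0 : A) = 0.
Proof. by rewrite -(scale0r (0 : A)) starZ conjC0 !scale0r. Qed.

Lemma starN x : star (- x) = - star x.
Proof. by rewrite -scaleN1r starZ rmorphN1 scaleN1r. Qed.

Lemma starB x y : star (x - y) = star x - star y.
Proof. by rewrite starD starN. Qed.

Lemma star1 : star (1 : A) = 1.
Proof. by rewrite -[LHS]mul1r -{1}(starK 1) -starM mul1r starK. Qed.

Lemma star_sum I (r : seq I) (P : pred I) (F : I -> A) :
  star (\sum_(i <- r | P i) F i) = \sum_(i <- r | P i) star (F i).
Proof. exact: (big_morph _ (@starD _ _) star0). Qed.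

Lemma cnorm1 : cnorm (1 : A) = 1.
Proof.
have n1 : cnorm (1 : A) != 0.
  by apply/eqP => /cnorm_eq0 /eqP; rewrite oner_eq0.
by apply: (mulfI n1); rewrite mulr1 -expr2 -cnorm_star star1 mulr1.
Qed.

Lemma cnorm_starE x : cnorm (star x) = cnorm x.
Proof.
have le y : cnorm y <= cnorm (star y).
  have [->|n0] := eqVneq (cnorm y) 0; first exact: cnorm_ge0.
  rewrite -(ler_pM2r (_ : 0 < cnorm y)) ?lt_neqAle 1?eq_sym ?n0 ?cnorm_ge0 //.
  by rewrite -expr2 -cnorm_star cnormM.
by apply/eqP; rewrite eq_le le -{2}(starK x) le.
Qed.

Lemma unitary1 : unitary (1 : A).
Proof. by split; rewrite star1 mulr1. Qed.

Lemma unitaryM w z : unitary w -> unitary z -> unitary (w * z).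
Proof.
move=> [w1 w2] [z1 z2]; split; rewrite starM mulrA.
  by rewrite -(mulrA (star z)) w1 mulr1.
by rewrite -(mulrA w) z2 mulr1.
Qed.

Lemma cnorm_unitary w : unitary w -> cnorm w = 1.
Proof.
case=> h _; have := cnorm_star w; rewrite h cnorm1 => /esym/eqP.
by rewrite sqrf_eq1 => /orP[/eqP//|/eqP e]; have := cnorm_ge0 w; rewrite e oppr_ge0 ler10.
Qed.

Lemma cnorm_Ad_le w x : unitary w -> cnorm (Ad w x) <= cnorm x.
Proof.
move=> uw; apply: le_trans (cnormM _ _) _; rewrite cnorm_starE (cnorm_unitary uw) mulr1.
by apply: le_trans (cnormM _ _) _; rewrite (cnorm_unitary uw) mul1r.
Qed.

Lemma Ad_star_hom w : unitary w -> star_hom (Ad w).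
Proof.
case=> h1 h2; split.
- by move=> a x y; rewrite /Ad mulrDr mulrDl -scalerAr -scalerAl.
- move=> x y; rewrite /Ad !mulrA; congr (_ * _ * _).
  by rewrite -(mulrA (w * x)) h1 mulr1.
- by rewrite /Ad mulr1.
- by move=> x; rewrite /Ad !starM starK mulrA.
Qed.

Lemma AdM w z x : Ad (w * z) x = Ad w (Ad z x).
Proof. by rewrite /Ad starM !mulrA. Qed.

Lemma Ad_comm w x : unitary w -> w * x = x * w -> Ad w x = x.
Proof. by case=> _ h2 c; rewrite /Ad c -mulrA h2 mulr1. Qed.

End CstarNorm.
#[global] Hint Resolve cnorm_ge0 : core.

(** * Convergence in norm *)

Section NullSequences.
Variables (R : realType) (A : cstarType R).
Implicit Types (x y : nat -> A) (a b l m : A).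

Lemma null_seqP x :
  null_seq x <-> forall e, 0 < e ->
    exists N : nat, forall n, (N <= n)%N -> cnorm (x n) < e.
Proof.
split.
- move=> /cvgrPdist_lt h e e0; have [N _ hN] := h e e0.
  exists N => n /hN /=; by rewrite sub0r normrN ger0_norm ?cnorm_ge0.
- move=> h; apply/cvgrPdist_lt => e e0; have [N hN] := h e e0.
  by exists N => // n /= /hN; rewrite sub0r normrN ger0_norm ?cnorm_ge0.
Qed.

Lemma null_seq_le (r : nat -> R) x :
  r n @[n --> \oo] --> (0 : R) -> (forall n, cnorm (x n) <= r n) -> null_seq x.
Proof.
move=> r0 h; apply: (@squeeze_cvgr _ _ _ _ (fun=> 0) r) => //.
  by near=> n; rewrite cnorm_ge0 h.
exact: cvg_cst.
Unshelve. all: by end_near. Qed.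

End NullSequences.

Lemma null_seq_scale (R : realType) (A B : cstarType R) (r : R)
    (x : nat -> A) (y : nat -> B) :
  (forall n, cnorm (y n) <= r * cnorm (x n)) -> null_seq x -> null_seq y.
Proof.
move=> h hx; apply: (@null_seq_le _ _ (fun n => r * cnorm (x n))) => //.
by rewrite -(mulr0 r); apply: cvgM => //; exact: cvg_cst.
Qed.

Section Limits.
Variables (R : realType) (A : cstarType R).
Implicit Types (x y : nat -> A) (a b l m : A).

Lemma null_seqD x y : null_seq x -> null_seq y -> null_seq (fun n => x n + y n).
Proof.
move=> hx hy; apply: (@null_seq_le _ _ (fun n => cnorm (x n) + cnorm (y n))).
  by rewrite -(addr0 0); exact: cvgD.
by move=> n; exact: cnormD.
Qed.

Lemma null_seqN x : null_seq x -> null_seq (fun n => - x n).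
Proof. by apply: (@null_seq_scale _ _ _ 1) => n; rewrite cnormN mul1r. Qed.

Lemma null_seqZ (c : R[i]) x : null_seq x -> null_seq (fun n => c *: x n).
Proof. by apply: (@null_seq_scale _ _ _ (normc c)) => n; rewrite cnormZr. Qed.

Lemma null_seqMl a x : null_seq x -> null_seq (fun n => a * x n).
Proof. by apply: (@null_seq_scale _ _ _ (cnorm a)) => n; exact: cnormM. Qed.

Lemma null_seqMr a x : null_seq x -> null_seq (fun n => x n * a).
Proof. by apply: (@null_seq_scale _ _ _ (cnorm a)) => n; rewrite mulrC; exact: cnormM. Qed.

Lemma null_seq_star x : null_seq x -> null_seq (fun n => star (x n)).
Proof. by apply: (@null_seq_scale _ _ _ 1) => n; rewrite cnorm_starE mul1r. Qed.

Lemma null_seqM x y : null_seq x -> null_seq y -> null_seq (fun n => x n * y n).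
Proof.
move=> hx hy; apply: (@null_seq_le _ _ (fun n => cnorm (x n) * cnorm (y n))).
  by rewrite -(mulr0 0); exact: cvgM.
by move=> n; exact: cnormM.
Qed.

Lemma null_seq_near x (N : nat) : (forall n, (N <= n)%N -> x n = 0) -> null_seq x.
Proof.
by move=> h; apply/null_seqP => e e0; exists N => n /h ->; rewrite cnorm0.
Qed.

Lemma null_seq_ext x y : (forall n, x n = y n) -> null_seq x -> null_seq y.
Proof. by move=> /funext ->. Qed.

Lemma null_seq_cst a : null_seq (fun=> a) -> a = 0.
Proof.
move=> /null_seqP h; apply: cnorm_eq0; apply/eqP; rewrite eq_le cnorm_ge0 andbT.
by rewrite leNgt; apply/negP => /h[N /(_ N (leqnn N))]; rewrite ltxx.
Qed.

Definition tends x l := null_seq (fun n => x n - l).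

Lemma tends_unique x l m : tends x l -> tends x m -> l = m.
Proof.
move=> hl hm; apply/eqP; rewrite -subr_eq0; apply/eqP.
apply: null_seq_cst; have := null_seqD hm (null_seqN hl).
by apply: null_seq_ext => n; rewrite opprB addrC addrA subrK.
Qed.

Lemma tends_near x l (N : nat) : (forall n, (N <= n)%N -> x n = l) -> tends x l.
Proof. by move=> h; apply: (@null_seq_near _ N) => n /h ->; rewrite subrr. Qed.

Lemma tendsD x y l m : tends x l -> tends y m -> tends (fun n => x n + y n) (l + m).
Proof.
by move=> hx hy; apply: null_seq_ext (null_seqD hx hy) => n; rewrite opprD addrACA.
Qed.

Lemma tendsZ (c : R[i]) x l : tends x l -> tends (fun n => c *: x n) (c *: l).
Proof.
by move=> hx; apply: null_seq_ext (null_seqZ c hx) => n; rewrite scalerBr.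
Qed.

Lemma tendsM x y l m : tends x l -> tends y m -> tends (fun n => x n * y n) (l * m).
Proof.
move=> hx hy.
apply: null_seq_ext (null_seqD (null_seqM hx hy)
  (null_seqD (null_seqMr m hx) (null_seqMl l hy))) => n.
by rewrite addrA -mulrDr subrK mulrBl mulrBr addrA subrK.
Qed.

Lemma tends_star x l : tends x l -> tends (fun n => star (x n)) (star l).
Proof. by move=> hx; apply: null_seq_ext (null_seq_star hx) => n; rewrite starB. Qed.

End Limits.

(** * Continuity of *-homomorphisms *)

Section StarHom.
Variable R : realType.

Section Basics.
Variables (A B : cstarType R) (f : A -> B) (hf : star_hom f).

Lemma star_homD x y : f (x + y) = f x + f y.
Proof. by rewrite -[x in LHS]scale1r (star_hom_linear hf) scale1r. Qed.

Lemma star_hom0 : f 0 = 0.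
Proof. by apply: (addrI (f 0)); rewrite -star_homD !addr0. Qed.

Lemma star_homZ a x : f (a *: x) = a *: f x.
Proof. by rewrite -[a *: x]addr0 (star_hom_linear hf) star_hom0 addr0. Qed.

Lemma star_homN x : f (- x) = - f x.
Proof. by rewrite -scaleN1r star_homZ scaleN1r. Qed.

Lemma star_homB x y : f (x - y) = f x - f y.
Proof. by rewrite star_homD star_homN. Qed.

Lemma star_hom_unitary w : unitary w -> unitary (f w).
Proof.
by case=> h1 h2; split; rewrite -(star_hom_star hf) -(star_homM hf) ?h1 ?h2 (star_hom1 hf).
Qed.

End Basics.

Lemma star_hom_id (A : cstarType R) : star_hom (@id A).
Proof. by split. Qed.

Lemma star_hom_comp (A B C : cstarType R) (f : A -> B) (g : B -> C) :
  star_hom f -> star_hom g -> star_hom (g \o f).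
Proof.
move=> hf hg; split=> [a x y|x y||x] /=.
- by rewrite (star_hom_linear hf) (star_hom_linear hg).
- by rewrite (star_homM hf) (star_homM hg).
- by rewrite (star_hom1 hf) (star_hom1 hg).
- by rewrite (star_hom_star hf) (star_hom_star hg).
Qed.

End StarHom.

Section SquareRoot.
Variables (R : realType) (A : cstarType R).

Lemma normc_real (r : R) : normc r%:C%C = `|r|.
Proof. by rewrite /normc /= expr0n addr0 sqrtr_sqr. Qed.

Lemma conjC_realC (r : R) : (r%:C%C : R[i])^* = r%:C%C.
Proof. by apply/CrealP; rewrite complex_real. Qed.

Let half : R[i] := (2^-1 : R)%:C%C.

Let halfD (x : A) : half *: x + half *: x = x.
Proof.
rewrite -scalerDl -rmorphD /= (_ : 2^-1 + 2^-1 = 1 :> R) ?scale1r//.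
by lra.
Qed.

Let cnorm_half (x : A) : cnorm (half *: x) = 2^-1 * cnorm x.
Proof. by rewrite cnormZr normc_real ger0_norm// invr_ge0. Qed.

(** Successive approximations to the solution [1 - sqrt (1 - y)] of the fixed
    point equation [z = (y + z ^ 2) / 2]. *)
Let z (y : A) (n : nat) : A := iter n (fun z => half *: (y + z * z)) 0.

(** If [y] has norm at most [3 / 4], then [z |-> (y + z ^ 2) / 2] maps the ball
    of radius [1 / 2] into itself and divides distances by [2] there, so its
    iterates converge. They are polynomials in [y]; hence the limit is
    self-adjoint and commutes with whatever commutes with [y]. *)
Lemma sqrt_one_sub (y : A) : star y = y -> cnorm y <= 3 / 4 ->
  exists k : A, [/\ star k = k, k * k = 1 - y &
                 forall a, a * y = y * a -> a * k = k * a].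
Proof.
move=> ys yle.
have zS n : z y n.+1 = half *: (y + z y n * z y n) by [].
have zle n : cnorm (z y n) <= 2^-1.
  elim: n => [|n ih]; first by rewrite /z /= cnorm0 invr_ge0.
  rewrite zS cnorm_half; have := cnormD y (z y n * z y n).
  have := cnormM (z y n) (z y n); have := cnorm_ge0 (z y n).
  nra.
have dz n : cnorm (z y n.+1 - z y n) <= 2^-1 ^+ n.
  elim: n => [|n ih].
    rewrite zS /z /= subr0 mulr0 addr0 cnorm_half expr0; lra.
  rewrite {1}zS (zS n) -scalerBr cnorm_half exprS.
  rewrite opprD addrACA subrr add0r.
  have -> : z y n.+1 * z y n.+1 - z y n * z y n =
     z y n.+1 * (z y n.+1 - z y n) + (z y n.+1 - z y n) * z y n.
    by rewrite mulrBr mulrBl addrA subrK.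
  set d := z y n.+1 - z y n in ih *.
  have := cnormD (z y n.+1 * d) (d * z y n).
  have := cnormM (z y n.+1) d; have := cnormM d (z y n).
  have := zle n; have := zle n.+1; have := cnorm_ge0 d; nra.
have dzk n k : cnorm (z y (n + k) - z y n) + 2 * 2^-1 ^+ (n + k) <= 2 * 2^-1 ^+ n.
  elim: k => [|k ih]; first by rewrite addn0 subrr cnorm0 add0r.
  rewrite addnS exprS; have := dz (n + k)%N.
  have := cnormD (z y (n + k).+1 - z y (n + k)) (z y (n + k) - z y n).
  rewrite addrA subrK; lra.
have [e e0|l hl] := @cnorm_complete _ A (z y).
  have : 2 * 2^-1 ^+ n @[n --> \oo] --> (0 : R).
    rewrite -(mulr0 2); apply: cvgM; first exact: cvg_cst.
    by apply: cvg_expr; rewrite ger0_norm ?invr_ge0//; lra.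
  move=> /cvgrPdist_lt/(_ _ e0)[N _ hN]; exists N.
  have hN' m n : (N <= n)%N -> (n <= m)%N -> cnorm (z y m - z y n) < e.
    move=> Nn nm; have := hN _ Nn; rewrite /= sub0r normrN ger0_norm; last first.
      by rewrite mulr_ge0// exprn_ge0// invr_ge0.
    apply: le_lt_trans; rewrite -(subnKC nm); have := dzk n (m - n)%N.
    have : 0 <= (2^-1 : R) ^+ (n + (m - n)) by rewrite exprn_ge0 ?invr_ge0.
    lra.
  move=> m n Nm Nn; have [|/ltnW] := leqP n m; first exact: hN'.
  by rewrite cdistC; exact: hN'.
have zl : tends (z y) l by [].
have lE : l = half *: (y + l * l).
  apply: (@tends_unique _ _ (fun n => z y n.+1)).
    move: zl => /null_seqP h; apply/null_seqP => e /h[N hN].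
    by exists N => n Nn; apply: hN; exact: leqW.
  apply: tendsZ; apply: tendsD; last exact: tendsM.
  by apply: (@tends_near _ _ _ _ 0%N).
have lc a : a * y = y * a -> a * l = l * a.
  move=> ay; have zc n : a * z y n = z y n * a.
    elim: n => [|n ih]; first by rewrite /z /= mulr0 mul0r.
    by rewrite zS -scalerAr -scalerAl mulrDr mulrDl ay mulrA ih -mulrA ih mulrA.
  have t0 := @tends_near _ _ (fun=> a) a 0%N (fun _ _ => erefl).
  apply: (@tends_unique _ _ (fun n => a * z y n)); first exact: tendsM.
  by under eq_fun do rewrite zc; exact: tendsM.
have ls : star l = l.
  have zs n : star (z y n) = z y n.
    elim: n => [|n ih]; first by rewrite /z /= star0.
    by rewrite zS starZ conjC_realC starD starM ys ih.
  apply: (@tends_unique _ _ (fun n => star (z y n))); first exact: tends_star.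
  by under eq_fun do rewrite zs.
exists (1 - l); split.
- by rewrite starB star1 ls.
- have ll : l + l = y + l * l by rewrite {1 2}lE halfD.
  rewrite mulrBr mulr1 mulrBl mul1r opprB -addrA (addrC (- l)) -addrA -opprD ll.
  by rewrite opprD (addrCA (l * l)) subrr addr0.
- by move=> a /lc h; rewrite mulrBl mulrBr h mul1r mulr1.
Qed.
End SquareRoot.

Section Boundedness.
Variables (R : realType) (A B : cstarType R) (f : A -> B) (hf : star_hom f).

Let I : R[i] := Complex 0 1.
Let conjI : I^* = - I.
Proof. by rewrite /I complexiE conjCi. Qed.
Let sqrI : I * I = -1.
Proof. by rewrite -expr2 /I sqr_i. Qed.

(** A self-adjoint [h] of small norm is the real part of the unitary
    [h + i sqrt (1 - h ^ 2)], and a *-homomorphism maps unitaries to unitaries,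
    which have norm [1]. *)
Lemma star_hom_le1 (h : A) : star h = h -> cnorm h <= 2^-1 -> cnorm (f h) <= 1.
Proof.
move=> hs hle.
have [||k [ks kk kc]] := @sqrt_one_sub _ _ (h * h).
- by rewrite starM hs.
- have := cnormM h h; have := cnorm_ge0 h; nra.
have kh : h * k = k * h by apply: kc; rewrite mulrA.
pose u := h + I *: k.
have us : star u = h - I *: k by rewrite starD starZ ks hs conjI scaleNr.
have uu : unitary u.
  have e : h * h + k * k = 1 by rewrite kk addrC subrK.
  split; rewrite us mulrDl !mulrDr ?mulrN ?mulNr -!(scalerAr, scalerAl).
    by rewrite scalerA sqrI scaleN1r kh opprK addrA addrK.
  by rewrite scalerA sqrI scaleN1r kh opprK addrA subrK.
have e : f h = (2^-1 : R)%:C%C *: (f u + star (f u)).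
  rewrite -(star_hom_star hf) -(star_homD hf) us addrACA subrr addr0.
  rewrite -(star_homZ hf) -[h in h + h]scale1r -scalerDl scalerA.
  by rewrite -(rmorph1 (real_complex R)) -rmorphD -rmorphM /= mulVf ?scale1r//; lra.
have n1 := cnorm_unitary (star_hom_unitary hf uu).
rewrite e cnormZr normc_real; have := cnormD (f u) (star (f u)).
by rewrite cnorm_starE n1 ger0_norm ?invr_ge0//; lra.
Qed.

(** The C*-identity reduces the estimate to [star x * x], which is scaled into
    the ball where the preceding lemma applies. The constant is not optimal, but
    it gives what is wanted: *-homomorphisms are automatically continuous. *)
Lemma star_hom_bounded (x : A) : cnorm (f x) ^+ 2 <= 2 * cnorm x ^+ 2.
Proof.
have [x0|n0] := eqVneq (cnorm x) 0.
  by rewrite (cnorm_eq0 _ x0) (star_hom0 hf) !cnorm0 expr0n mulr0.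
have n2 : 0 < 2 * cnorm x ^+ 2.
  by rewrite mulr_gt0// exprn_gt0// lt_neqAle eq_sym n0 cnorm_ge0.
set r := 2 * _ in n2 *.
have := @star_hom_le1 ((r^-1)%:C%C *: (star x * x)).
rewrite starZ conjC_realC starM starK => /(_ erefl).
rewrite (star_homZ hf) (star_homM hf) (star_hom_star hf) !cnormZr !cnorm_star.
rewrite normc_real ger0_norm ?invr_ge0 ?(ltW n2)// => h.
rewrite -(ler_pM2l (_ : 0 < r^-1)) ?invr_gt0// mulVf ?gt_eqF//; apply: h.
by rewrite /r invfM -mulrA mulVf ?mulr1// expf_neq0.
Qed.

Lemma star_hom_cnorm_le (x : A) : cnorm (f x) <= 2 * cnorm x.
Proof.
rewrite -(ler_pXn2r (ltn0Sn 1)) ?nnegrE ?mulr_ge0 ?cnorm_ge0//.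
apply: le_trans (star_hom_bounded x) _; rewrite exprMn ler_wpM2r ?sqr_ge0//; lra.
Qed.

Lemma star_hom_tends x l : tends x l -> tends (f \o x) (f l).
Proof.
by apply: null_seq_scale => n /=; rewrite -(star_homB hf); exact: star_hom_cnorm_le.
Qed.

End Boundedness.

(** * Closed *-subalgebras *)

Section ClosedSubalgebras.
Variable R : realType.

Definition closed_star_subalgebra (A : cstarType R) (S : set A) : Prop :=
  star_subalgebra S /\ norm_closed S.

Section Basics.
Variables (A : cstarType R) (S : set A) (hS : star_subalgebra S).

Lemma star_subalgebraD x y : S x -> S y -> S (x + y).
Proof. by move=> Sx Sy; rewrite -[x]scale1r; exact: (star_subalgebraP hS). Qed.

Lemma star_subalgebra0 : S 0.
Proof.
have S1 := star_subalgebra1 hS.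
by rewrite -(addNr 1) -scaleN1r; exact: (star_subalgebraP hS).
Qed.

Lemma star_subalgebraZ a x : S x -> S (a *: x).
Proof.
by move=> Sx; rewrite -[_ *: _]addr0; apply: (star_subalgebraP hS) => //; exact: star_subalgebra0.
Qed.

Lemma star_subalgebra_sum I (r : seq I) (P : pred I) (F : I -> A) :
  (forall i, P i -> S (F i)) -> S (\sum_(i <- r | P i) F i).
Proof.
by move=> h; apply: big_ind => //;
  [exact: star_subalgebra0|exact: star_subalgebraD].
Qed.

End Basics.

Section Examples.
Variable A : cstarType R.

Lemma closed_star_subalgebraI (S T : set A) :
  closed_star_subalgebra S -> closed_star_subalgebra T ->
  closed_star_subalgebra (S `&` T).
Proof.
move=> [[S1 SP SM Ss] Sc] [[T1 TP TM Ts] Tc]; split; first split.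
- by [].
- by move=> a x y [? ?] [? ?]; split; [exact: SP|exact: TP].
- by move=> x y [? ?] [? ?]; split; [exact: SM|exact: TM].
- by move=> x [? ?]; split; [exact: Ss|exact: Ts].
- by move=> x l h t; split; [apply: Sc t => n|apply: Tc t => n]; case: (h n).
Qed.

Lemma closed_star_commutant (T : set A) : (forall b, T b -> T (star b)) ->
  closed_star_subalgebra [set x | forall b, T b -> x * b = b * x].
Proof.
move=> Ts; split; first split => /=.
- by move=> b _; rewrite mul1r mulr1.
- by move=> a x y cx cy b Tb; rewrite mulrDl mulrDr -scalerAl -scalerAr cx// cy.
- by move=> x y cx cy b Tb; rewrite -mulrA cy// mulrA cx// mulrA.
- by move=> x cx b /Ts Tb; apply: (can_inj (@starK _ A)); rewrite !starM starK cx.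
- move=> x l h t b Tb.
  have t0 := @tends_near _ _ (fun=> b) b 0%N (fun _ _ => erefl).
  apply: (@tends_unique _ _ (fun n => x n * b)); first exact: tendsM t t0.
  by under eq_fun => n do rewrite h//; exact: tendsM.
Qed.

Lemma closed_star_equalizer (B : cstarType R) (f g : A -> B) :
  star_hom f -> star_hom g -> closed_star_subalgebra [set x | f x = g x].
Proof.
move=> hf hg; split; first split => /=.
- by rewrite (star_hom1 hf) (star_hom1 hg).
- by move=> a x y fx fy; rewrite (star_hom_linear hf) (star_hom_linear hg) fx fy.
- by move=> x y fx fy; rewrite (star_homM hf) (star_homM hg) fx fy.
- by move=> x fx; rewrite (star_hom_star hf) (star_hom_star hg) fx.
- move=> x l h t; apply: (@tends_unique _ _ (f \o x)); first exact: star_hom_tends.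
  have -> : f \o x = g \o x by apply/funext => n /=; exact: h.
  exact: star_hom_tends.
Qed.

(** By this lemma, contractive *-homomorphisms that converge at each element of
    a generating set converge everywhere. *)
Lemma closed_star_convergence (f : nat -> A -> A) :
  (forall n, star_hom (f n)) -> (forall n x, cnorm (f n x) <= cnorm x) ->
  closed_star_subalgebra [set x | exists l, tends (f^~ x) l].
Proof.
move=> hf fle; split; first split => /=.
- by exists 1; apply: (@tends_near _ _ _ _ 0%N) => n _; exact: star_hom1.
- move=> a x y [l tl] [m tm]; exists (a *: l + m).
  by under eq_fun => n do rewrite (star_hom_linear (hf n)); apply: tendsD => //; exact: tendsZ.
- move=> x y [l tl] [m tm]; exists (l * m).
  by under eq_fun => n do rewrite (star_homM (hf n)); exact: tendsM.
- move=> x [l tl]; exists (star l).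
  by under eq_fun => n do rewrite (star_hom_star (hf n)); exact: tends_star.
- move=> x l h /null_seqP t.
  (* The limit point is approximated by a point [x K] of convergence; the values
     at both differ little, uniformly in [n], by contractivity. *)
  apply: cnorm_complete => e e0; have e4 : 0 < e / 4 by lra.
  have [K /(_ K (leqnn _)) hK] := t _ e4; have [m /null_seqP/(_ _ e4)[N hN]] := h K.
  exists N => p q Np Nq.
  have -> : f p l - f q l = (f p (x K) - m) - (f q (x K) - m) - (f p (x K - l) - f q (x K - l)).
    rewrite !(star_homB (hf _)) [- (f q (x K) - m)]opprB addrA subrK.
    apply/eqP; rewrite eq_sym subr_eq addrACA -opprD.
    by rewrite [f p l + _]addrC [f q l + _]addrC !subrK.
  apply: le_lt_trans (cnormB _ _) _.
  have := cnormB (f p (x K) - m) (f q (x K) - m).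
  have := cnormB (f p (x K - l)) (f q (x K - l)).
  have := fle p (x K - l); have := fle q (x K - l).
  have /= := hN p Np; have /= := hN q Nq.
  lra.
Qed.

End Examples.
End ClosedSubalgebras.

Section SubCstar.
Variable R : realType.

(** Bundled so that the type of its elements has a canonical structure of
    C*-algebra. *)
Record cstar_sub (A : cstarType R) := CstarSub {
  cstar_sub_set :> set A;
  cstar_subP : closed_star_subalgebra cstar_sub_set }.

Variables (A : cstarType R) (S : cstar_sub A).

Definition cstar_sub_pred : {pred A} := fun x => `[< cstar_sub_set S x >].

Lemma cstar_sub_subalg_closed : GRing.subalg_closed cstar_sub_pred.
Proof.
have [hS _] := cstar_subP S.
split=> [|a x y /asboolP Sx /asboolP Sy|x y /asboolP Sx /asboolP Sy]; apply/asboolP.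
- exact: star_subalgebra1.
- exact: (star_subalgebraP hS).
- exact: (star_subalgebraM hS).
Qed.

HB.instance Definition _ := GRing.isSubalgClosed.Build R[i] A cstar_sub_pred
  cstar_sub_subalg_closed.

Record cstar_sub_type := CstarSubType {
  cstar_val : A; _ : cstar_val \in cstar_sub_pred }.

HB.instance Definition _ := [isSub for cstar_val].
HB.instance Definition _ := [Choice of cstar_sub_type by <:].
HB.instance Definition _ := [SubChoice_isSubAlgebra of cstar_sub_type by <:].

Lemma cstar_valP (x : cstar_sub_type) : cstar_sub_set S (cstar_val x).
Proof. by case: x => x /= /asboolP. Qed.

Definition cstar_in (x : A) (Sx : cstar_sub_set S x) : cstar_sub_type :=
  CstarSubType (introT (asboolP _) Sx : x \in cstar_sub_pred).

Lemma cstar_inK x (Sx : cstar_sub_set S x) : cstar_val (cstar_in Sx) = x.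
Proof. by []. Qed.

Lemma cstar_val_inj : injective cstar_val.
Proof. exact: val_inj. Qed.

Definition cstar_sub_star (x : cstar_sub_type) : cstar_sub_type :=
  cstar_in (star_subalgebra_star (cstar_subP S).1 (cstar_valP x)).

Lemma cstar_sub_complete (x : nat -> cstar_sub_type) :
    (forall e : R, 0 < e -> exists N : nat, forall m n : nat,
       (N <= m)%N -> (N <= n)%N -> cnorm (cstar_val (x m - x n)) < e) ->
  exists l, cnorm (cstar_val (x n - l)) @[n --> \oo] --> (0 : R).
Proof.
move=> cx; have [l hl] := @cnorm_complete _ A (cstar_val \o x) cx.
have Sl : cstar_sub_set S l.
  by apply: (cstar_subP S).2 hl => n; exact: cstar_valP.
by exists (cstar_in Sl).
Qed.

Fact cstar_sub_norm_eq0 (x : cstar_sub_type) : cnorm (cstar_val x) = 0 -> x = 0.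
Proof. by move=> /cnorm_eq0 x0; apply: cstar_val_inj. Qed.
Fact cstar_sub_starK : involutive cstar_sub_star.
Proof. by move=> x; apply: cstar_val_inj; exact: starK. Qed.
Fact cstar_sub_starD : {morph cstar_sub_star : x y / x + y}.
Proof. by move=> x y; apply: cstar_val_inj; exact: starD. Qed.
Fact cstar_sub_starZ (a : R[i]) x : cstar_sub_star (a *: x) = a^* *: cstar_sub_star x.
Proof. by apply: cstar_val_inj; exact: starZ. Qed.
Fact cstar_sub_starM x y : cstar_sub_star (x * y) = cstar_sub_star y * cstar_sub_star x.
Proof. by apply: cstar_val_inj; exact: starM. Qed.

HB.instance Definition _ := isCstar.Build R cstar_sub_type
  cstar_sub_norm_eq0 (fun x y => cnormD (cstar_val x) (cstar_val y))
  (fun a x => cnormZ a (cstar_val x)) (fun x y => cnormM (cstar_val x) (cstar_val y))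
  cstar_sub_complete cstar_sub_starK cstar_sub_starD cstar_sub_starZ cstar_sub_starM
  (fun x => cnorm_star (cstar_val x)).

Lemma cstar_val_hom : star_hom cstar_val.
Proof. by split. Qed.

End SubCstar.

(** * Square summable families *)

#[local] Existing Instance totally_filter.

Section UnorderedSums.
Variables (R : realType) (S : choiceType).
Implicit Types (phi psi : S -> R) (F : {fset S}).

Definition fset_sum phi F : R := \sum_(s <- F) phi s.

Lemma fset_sum_le phi F F' : (forall s, 0 <= phi s) ->
  (F `<=` F')%fset -> fset_sum phi F <= fset_sum phi F'.
Proof.
move=> phi0 /fsubsetP FF'; rewrite /fset_sum.
have -> : \sum_(s <- F) phi s = \sum_(s <- F' | s \in F) phi s.
  have e : perm_eq F [seq s <- F' | s \in F].
    apply: uniq_perm; rewrite ?filter_uniq ?fset_uniq// => s.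
    by rewrite mem_filter; case: (boolP (s \in F)) => //= /FF' ->.
  by rewrite (perm_big _ e) big_filter.
by rewrite [leRHS](bigID (mem F)) /= lerDl sumr_ge0.
Qed.

Definition unordered_sum phi : R := lim (fset_sum phi F @[F --> totally]).

Definition unordered_summable phi : Prop :=
  exists l : R, fset_sum phi F @[F --> totally] --> l.

Lemma unordered_sum_cvg phi : unordered_summable phi ->
  fset_sum phi F @[F --> totally] --> unordered_sum phi.
Proof. by case=> l h; rewrite /unordered_sum (cvg_lim _ h). Qed.

Lemma unordered_sumE phi l :
  fset_sum phi F @[F --> totally] --> l -> unordered_sum phi = l.
Proof. by move=> h; apply: cvg_lim. Qed.

Lemma unordered_summable_ge0 phi M : (forall s, 0 <= phi s) ->
  (forall F, fset_sum phi F <= M) -> unordered_summable phi.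
Proof.
move=> phi0 le; pose E := [set fset_sum phi F | F in setT].
have hE : has_sup E by split; [exists (fset_sum phi fset0); exists fset0|exists M => _ [F _ <-]].
exists (sup E); apply/cvgrPdist_lt => e e0.
have [_ [F _ <-] hF] := sup_adherent e0 hE.
exists F => // F' /= FF'; have h1 := fset_sum_le phi0 FF'.
have h2 : fset_sum phi F' <= sup E by apply: sup_ubound; [exact: hE.2|exists F'].
by rewrite ger0_norm ?subr_ge0//; lra.
Qed.

Lemma fset_sum_le_unordered_sum phi F : (forall s, 0 <= phi s) ->
  unordered_summable phi -> fset_sum phi F <= unordered_sum phi.
Proof.
move=> phi0 /unordered_sum_cvg h; apply: limr_ge.
  exact: cvgP h.
by exists F => // F' /=; exact: fset_sum_le.
Qed.

Lemma unordered_sum_le phi M : unordered_summable phi ->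
  (forall F, fset_sum phi F <= M) -> unordered_sum phi <= M.
Proof.
move=> /unordered_sum_cvg h le; apply: limr_le.
  exact: cvgP h.
by exists fset0.
Qed.

Lemma fset_sumD phi psi F :
  fset_sum (fun s => phi s + psi s) F = fset_sum phi F + fset_sum psi F.
Proof. exact: big_split. Qed.

Lemma fset_sumZ (c : R) phi F : fset_sum (fun s => c * phi s) F = c * fset_sum phi F.
Proof. by rewrite /fset_sum big_distrr. Qed.

Lemma unordered_cvgD phi psi l m :
  fset_sum phi F @[F --> totally] --> l -> fset_sum psi F @[F --> totally] --> m ->
  fset_sum (fun s => phi s + psi s) F @[F --> totally] --> l + m.
Proof. by move=> hl hm; under eq_fun => F do rewrite fset_sumD; exact: cvgD. Qed.

Lemma unordered_cvgZ (c : R) phi l :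
  fset_sum phi F @[F --> totally] --> l ->
  fset_sum (fun s => c * phi s) F @[F --> totally] --> c * l.
Proof.
move=> hl; under eq_fun => F do rewrite fset_sumZ.
by apply: cvgM => //; exact: cvg_cst.
Qed.

End UnorderedSums.

(** The Hilbert space of square summable complex families is equipped with the
    real part of its inner product only. For complex linear operators, adjoints
    with respect to the real part are adjoints in the usual sense, and only sums
    of real families have to be handled. *)
Section SquareSummable.
Variables (R : realType) (S : choiceType).

(** The real part of [z * w^*]. *)
Definition rdot (z w : R[i]) : R :=
  complex.Re z * complex.Re w + complex.Im z * complex.Im w.

Lemma rdotC z w : rdot z w = rdot w z.
Proof. by rewrite /rdot; ring. Qed.

Lemma rdotDl z z' w : rdot (z + z') w = rdot z w + rdot z' w.
Proof. by case: z => a b; case: z' => a' b'; rewrite /rdot /=; ring. Qed.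

Lemma rdotZl a z w : rdot (a * z) w = rdot z (a^* * w).
Proof.
have -> : a^* = (complex.Re a -i* complex.Im a)%C by case: a.
by case: a => a b; case: z => x y; case: w => u v; rewrite /rdot /=; ring.
Qed.

Lemma rdot_ge0 z : 0 <= rdot z z.
Proof. by rewrite /rdot; nra. Qed.

Lemma rdot_eq0 z : rdot z z = 0 -> z = 0.
Proof.
case: z => a b; rewrite /rdot /= -!expr2 => /eqP.
by rewrite paddr_eq0 ?sqr_ge0// !sqrf_eq0 => /andP[/eqP -> /eqP ->].
Qed.

Lemma rdot_normc z : rdot z z = normc z ^+ 2.
Proof.
case: z => a b; rewrite /rdot /normc /= sqr_sqrtr ?addr_ge0 ?sqr_ge0//; ring.
Qed.

Lemma rdot_polar z w : rdot z w =
  4^-1 * rdot (z + w) (z + w) + (- 4^-1) * rdot (z - w) (z - w).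
Proof. by case: z => a b; case: w => c d; rewrite /rdot /=; field. Qed.

Lemma rdotD_le z w : rdot (z + w) (z + w) <= 2 * rdot z z + 2 * rdot w w.
Proof.
case: z => a b; case: w => c d; rewrite /rdot /=.
by have := sqr_ge0 (a - c); have := sqr_ge0 (b - d); nra.
Qed.

Definition square_summable (f : S -> R[i]^o) : Prop :=
  exists M : R, forall F : {fset S}, fset_sum (fun s => rdot (f s) (f s)) F <= M.

Definition l2_pred : {pred S -> R[i]^o} := fun f => `[< square_summable f >].

Lemma square_summableD f g : square_summable f -> square_summable g ->
  square_summable (f + g).
Proof.
move=> [M hM] [N hN]; exists (2 * M + 2 * N) => F.
apply: (@le_trans _ _ (fset_sum (fun s => 2 * rdot (f s) (f s) + 2 * rdot (g s) (g s)) F)).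
  by apply: ler_sum => s _; exact: rdotD_le.
by rewrite fset_sumD !fset_sumZ; have := hM F; have := hN F; lra.
Qed.

Lemma square_summableZ a f : square_summable f -> square_summable (a *: f).
Proof.
move=> [M hM]; exists (normc a ^+ 2 * M) => F.
apply: (@le_trans _ _ (fset_sum (fun s => normc a ^+ 2 * rdot (f s) (f s)) F)).
  apply: ler_sum => s _; rewrite /= [X in rdot X X](_ : _ = a * f s)//.
  by rewrite !rdot_normc ComplexField.Normc.normcM exprMn.
by rewrite fset_sumZ ler_wpM2l ?sqr_ge0.
Qed.

Lemma l2_submod_closed : GRing.submod_closed l2_pred.
Proof.
split=> [|a f g /asboolP hf /asboolP hg]; apply/asboolP.
  by exists 0 => F; rewrite /fset_sum big1// => s _; rewrite /rdot !mulr0 addr0.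
by apply: square_summableD => //; exact: square_summableZ.
Qed.

HB.instance Definition _ := GRing.isSubmodClosed.Build R[i] (S -> R[i]^o) l2_pred
  l2_submod_closed.

Record l2 := L2 { l2_fun :> S -> R[i]^o; _ : l2_fun \in l2_pred }.

HB.instance Definition _ := [isSub for l2_fun].
HB.instance Definition _ := [Choice of l2 by <:].
HB.instance Definition _ := [SubChoice_isSubLmodule of l2 by <:].

Implicit Types (f g h : l2) (a : R[i]).

Lemma l2P f : square_summable f.
Proof. by case: f => f /= /asboolP. Qed.

Definition mk_l2 (f : S -> R[i]) (hf : square_summable f) : l2 :=
  L2 (introT (asboolP _) hf : f \in l2_pred).

Lemma l2_eq f g : (forall s, f s = g s) -> f = g.
Proof. by move=> fg; apply: val_inj; apply/funext. Qed.

Lemma l2_addE f g s : (f + g) s = f s + g s. Proof. by []. Qed.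
Lemma l2_scaleE a f s : (a *: f) s = a * f s. Proof. by []. Qed.

Definition rip f g : R := unordered_sum (fun s => rdot (f s) (g s)).

Lemma rip_summable_diag f : unordered_summable (fun s => rdot (f s) (f s)).
Proof.
have [M hM] := l2P f; apply: unordered_summable_ge0 hM => s; exact: rdot_ge0.
Qed.

(** Polarization reduces the convergence to that of sums of nonnegative terms. *)
Lemma rip_cvg f g :
  fset_sum (fun s => rdot (f s) (g s)) F @[F --> totally] --> rip f g.
Proof.
apply: unordered_sum_cvg; eexists.
under eq_fun => F do (under eq_fun => s do rewrite rdot_polar).
apply: unordered_cvgD; apply: unordered_cvgZ; apply: unordered_sum_cvg.
  exact: (rip_summable_diag (f + g)).
exact: (rip_summable_diag (f - g)).
Qed.

Lemma ripC f g : rip f g = rip g f.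
Proof. by rewrite /rip; under eq_fun => s do rewrite rdotC. Qed.

Lemma ripDl f g h : rip (f + g) h = rip f h + rip g h.
Proof.
apply: unordered_sumE; under eq_fun => F do (under eq_fun => s do rewrite l2_addE rdotDl).
by apply: unordered_cvgD; exact: rip_cvg.
Qed.

Lemma ripDr f g h : rip h (f + g) = rip h f + rip h g.
Proof. by rewrite ripC ripDl !(ripC h). Qed.

Lemma ripZl a f g : rip (a *: f) g = rip f (a^* *: g).
Proof. by rewrite /rip; under eq_fun => s do rewrite l2_scaleE rdotZl. Qed.

Lemma ripZr a f g : rip f (a *: g) = rip (a^* *: f) g.
Proof. by rewrite ripZl conjCK. Qed.

Lemma ripZr_real (r : R) f g : rip f (r%:C%C *: g) = r * rip f g.
Proof.
rewrite {1}/rip (_ : (fun s => _) = fun s => r * rdot (f s) (g s)).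
  by apply: unordered_sumE; apply: unordered_cvgZ; exact: rip_cvg.
apply/funext => s; rewrite l2_scaleE.
by case: (f s) => x y; case: (g s) => u v; rewrite /rdot /=; ring.
Qed.

Lemma ripZl_real (r : R) f g : rip (r%:C%C *: f) g = r * rip f g.
Proof. by rewrite ripC ripZr_real ripC. Qed.

Lemma ripNl f g : rip (- f) g = - rip f g.
Proof. by rewrite -scaleN1r -(rmorphN1 (real_complex R)) ripZl_real mulN1r. Qed.

Lemma ripNr f g : rip g (- f) = - rip g f.
Proof. by rewrite ripC ripNl ripC. Qed.

Lemma rip0l f : rip 0 f = 0.
Proof. by rewrite -(scale0r 0) -(rmorph0 (real_complex R)) ripZl_real mul0r. Qed.

Lemma fset_sum_le_rip f F : fset_sum (fun s => rdot (f s) (f s)) F <= rip f f.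
Proof.
apply: fset_sum_le_unordered_sum; first by move=> s; exact: rdot_ge0.
exact: rip_summable_diag.
Qed.

Lemma rip_ge0 f : 0 <= rip f f.
Proof. by apply: le_trans (fset_sum_le_rip f fset0); rewrite /fset_sum big_seq_fset0. Qed.

Lemma rdot_le_rip f s : rdot (f s) (f s) <= rip f f.
Proof. by have := fset_sum_le_rip f [fset s]%fset; rewrite /fset_sum big_seq_fset1. Qed.

Lemma rip_eq0 f : rip f f = 0 -> f = 0.
Proof.
move=> h; apply: l2_eq => s; apply: rdot_eq0; apply/eqP.
by rewrite eq_le rdot_ge0 -h rdot_le_rip.
Qed.

Lemma rip_le f M : (forall F, fset_sum (fun s => rdot (f s) (f s)) F <= M) -> rip f f <= M.
Proof. by apply: unordered_sum_le; exact: rip_summable_diag. Qed.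

Lemma rip_sqr_le f g : rip f g ^+ 2 <= rip f f * rip g g.
Proof.
have [g0|n0] := eqVneq (rip g g) 0.
  by rewrite (rip_eq0 g0) ripC rip0l expr0n mulr_ge0// rip_ge0.
have gg : 0 < rip g g by rewrite lt_neqAle eq_sym n0 rip_ge0.
have := rip_ge0 ((rip g g)%:C%C *: f - (rip f g)%:C%C *: g).
(* The squared norm just introduced is [t * (t * w - u ^+ 2)]. *)
rewrite !(ripDl, ripDr, ripNl, ripNr, ripZl_real, ripZr_real) (ripC g f).
set t := rip g g in n0 gg *; set u := rip f g; set w := rip f f => h.
have : 0 <= t * (t * w - u ^+ 2) by apply: le_trans h _; rewrite le_eqVlt;
  apply/orP; left; apply/eqP; ring.
by rewrite pmulr_rge0// subr_ge0 mulrC.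
Qed.

Definition l2norm f : R := Num.sqrt (rip f f).

Lemma l2norm_ge0 f : 0 <= l2norm f. Proof. exact: sqrtr_ge0. Qed.

Lemma l2norm_sqr f : l2norm f ^+ 2 = rip f f.
Proof. by rewrite sqr_sqrtr ?rip_ge0. Qed.

Lemma l2norm_eq0 f : l2norm f = 0 -> f = 0.
Proof. by move=> h; apply: rip_eq0; rewrite -l2norm_sqr h expr0n. Qed.

Lemma l2norm0 : l2norm 0 = 0.
Proof. by rewrite /l2norm rip0l sqrtr0. Qed.

Lemma l2norm_le f (c : R) : 0 <= c -> rip f f <= c ^+ 2 -> l2norm f <= c.
Proof.
by move=> c0 h; rewrite -(ler_pXn2r (ltn0Sn 1)) ?nnegrE ?l2norm_ge0// l2norm_sqr.
Qed.

Lemma rip_le_l2norm f g : rip f g <= l2norm f * l2norm g.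
Proof.
have [r0|r0] := leP (rip f g) 0; first by apply: le_trans r0 _; rewrite mulr_ge0 ?l2norm_ge0.
rewrite -(ler_pXn2r (ltn0Sn 1)) ?nnegrE ?mulr_ge0 ?l2norm_ge0 ?(ltW r0)//.
by rewrite exprMn !l2norm_sqr rip_sqr_le.
Qed.

Lemma l2normD f g : l2norm (f + g) <= l2norm f + l2norm g.
Proof.
apply: l2norm_le; first by rewrite addr_ge0 ?l2norm_ge0.
rewrite ripDl !ripDr (ripC g f) sqrrD !l2norm_sqr; have := rip_le_l2norm f g; lra.
Qed.

Lemma l2normZ a f : l2norm (a *: f) = normc a * l2norm f.
Proof.
rewrite /l2norm ripZl scalerA -normCKC norm_complexE -rmorphXn ripZr_real.
by rewrite sqrtrM ?sqr_ge0// sqrtr_sqr ger0_norm// normc_ge0.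
Qed.

Lemma l2normN f : l2norm (- f) = l2norm f.
Proof. by rewrite -scaleN1r l2normZ normcN ComplexField.Normc.normc1 mul1r. Qed.

(** The limit is found coordinatewise; estimates on finite partial sums, uniform
    in the finite set, pass to the limit. *)
Lemma l2_complete (f : nat -> l2) :
  (forall e : R, 0 < e -> exists N : nat, forall m n : nat,
     (N <= m)%N -> (N <= n)%N -> l2norm (f m - f n) < e) ->
  exists l : l2, forall e : R, 0 < e -> exists N : nat, forall n : nat,
     (N <= n)%N -> l2norm (f n - l) <= e.
Proof.
move=> cf.
have /choice[l hl] : forall s, exists l, normc (f n s - l) @[n --> \oo] --> (0 : R).
  move=> s; apply: complex_complete => e e0; have [N hN] := cf e e0.
  exists N => m n Nm Nn; apply: le_lt_trans (hN m n Nm Nn).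
  rewrite -(ler_pXn2r (ltn0Sn 1)) ?nnegrE ?l2norm_ge0 ?normc_ge0//.
  by rewrite l2norm_sqr -rdot_normc; exact: (rdot_le_rip (f m - f n)).
have bound e : 0 < e -> exists N : nat, forall n, (N <= n)%N -> forall F,
    fset_sum (fun s => rdot (f n s - l s) (f n s - l s)) F <= e ^+ 2.
  move=> e0; have [N hN] := cf e e0; exists N => n Nn F.
  pose phi m := fset_sum (fun s => rdot (f n s - f m s) (f n s - f m s)) F.
  have cphi : phi m @[m --> \oo] --> fset_sum (fun s => rdot (f n s - l s) (f n s - l s)) F.
    rewrite /phi /fset_sum; elim: (enum_fset F) => [|s r ih].
      by under eq_fun do rewrite big_nil; rewrite big_nil; exact: cvg_cst.
    under eq_fun do rewrite big_cons.
    rewrite big_cons; apply: cvgD => //.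
    under eq_fun => m do rewrite rdot_normc expr2.
    rewrite rdot_normc expr2.
    suff h : normc (f n s - f m s) @[m --> \oo] --> normc (f n s - l s) by exact: cvgM.
    apply/cvgrPdist_le => d d0; move/cvgrPdist_le : (hl s) => /(_ d d0).
    apply: filterS => m; rewrite sub0r normrN ger0_norm ?normc_ge0//.
    apply: le_trans; rewrite ler_norml.
    have := le_normcD (f n s - f m s) (f m s - l s).
    have := le_normcD (f n s - l s) (- (f m s - l s)); rewrite normcN.
    rewrite opprB !addrA !subrK; lra.
  rewrite -(cvg_lim (@Rhausdorff R) cphi); apply: limr_le; first exact: cvgP cphi.
  exists N => // m Nm; apply: le_trans (fset_sum_le_rip (f n - f m) F) _.
  rewrite -l2norm_sqr ler_pXn2r ?nnegrE ?l2norm_ge0 ?(ltW e0)//.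
  by apply: ltW; exact: hN.
have [N /(_ N (leqnn _)) hN] := bound 1 ltr01.
have hd : square_summable (fun s => f N s - l s) by exists (1 ^+ 2).
exists (f N - mk_l2 hd) => e e0; have [M hM] := bound e e0; exists M => n Mn.
apply: l2norm_le; first exact: ltW.
apply: rip_le => F; apply: le_trans (hM n Mn F).
have e1 s : (f n - (f N - mk_l2 hd)) s = f n s - l s.
  by rewrite [LHS](_ : _ = f n s - (f N s - (f N s - l s)))// subKr.
rewrite (_ : (fun s => _) = fun s => rdot (f n s - l s) (f n s - l s))//.
by apply/funext => s; rewrite e1.
Qed.

End SquareSummable.

(** * Bounded operators on a Hilbert space *)

Section BoundedOperators.
Variables (R : realType) (S : pointedType).
Local Notation H := (l2 R S).
Implicit Types (f g : H).

(** The existence of an adjoint is demanded, rather than derived from boundedness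
    by the Riesz representation theorem. *)
Record bounded_operator_on (T : H -> H) : Prop := {
  operator_linear : linear T;
  operator_bounded : exists C : R, forall f, l2norm (T f) <= C * l2norm f;
  operator_adjoint : exists T' : H -> H, forall f g, rip (T f) g = rip f (T' g)
}.

Definition bounded_operator_pred : {pred H -> H} := fun T => `[< bounded_operator_on T >].

Lemma bounded_operator_submod_closed : GRing.submod_closed bounded_operator_pred.
Proof.
split=> [|a T U /asboolP[lT [C hC] [T' hT]] /asboolP[lU [D hD] [U' hU]]]; apply/asboolP.
  split; first by move=> a f g; rewrite scaler0 addr0.
    by exists 0 => f; rewrite mul0r l2norm0.
  by exists (fun=> 0) => f g; rewrite [RHS]ripC rip0l; exact: rip0l.
split.
- move=> b f g.
  rewrite [LHS](_ : _ = a *: T (b *: f + g) + U (b *: f + g))//.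
  rewrite lT lU [RHS](_ : _ = b *: (a *: T f + U f) + (a *: T g + U g))//.
  by rewrite !scalerDr !scalerA (mulrC a b) addrACA.
- exists (normc a * C + D) => f; rewrite [leLHS](_ : _ = l2norm (a *: T f + U f))//.
  apply: le_trans (l2normD _ _) _.
  by rewrite l2normZ mulrDl lerD// -mulrA ler_wpM2l// normc_ge0.
- exists (fun g => T' (a^* *: g) + U' g) => f g.
  by rewrite [LHS](_ : _ = rip (a *: T f + U f) g)// ripDl ripZl hT hU ripDr.
Qed.

HB.instance Definition _ := GRing.isSubmodClosed.Build R[i] (H -> H)
  bounded_operator_pred bounded_operator_submod_closed.

(** The index set is pointed so that the Hilbert space is nonzero and the
    operators form a nontrivial ring. *)
Record bop := Bop { bop_fun :> H -> H; _ : bop_fun \in bounded_operator_pred }.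

HB.instance Definition _ := [isSub for bop_fun].
HB.instance Definition _ := [Choice of bop by <:].
HB.instance Definition _ := [SubChoice_isSubLmodule of bop by <:].

Implicit Types T U : bop.

Lemma bopP T : bounded_operator_on T.
Proof. by case: T => T /= /asboolP. Qed.

Definition mk_bop (T : H -> H) (hT : bounded_operator_on T) : bop :=
  Bop (introT (asboolP _) hT : T \in bounded_operator_pred).

Lemma bop_eq T U : (forall f, T f = U f) -> T = U.
Proof. by move=> TU; apply: val_inj; apply/funext. Qed.

Lemma bop_addE T U f : (T + U) f = T f + U f. Proof. by []. Qed.
Lemma bop_scaleE a T f : (a *: T) f = a *: T f. Proof. by []. Qed.

Lemma bop_linear T : linear T. Proof. exact: operator_linear (bopP T). Qed.

Lemma bopD T f g : T (f + g) = T f + T g.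
Proof. by rewrite -[f in LHS]scale1r bop_linear scale1r. Qed.

Lemma bop0 T : T 0 = 0.
Proof. by apply: (addrI (T 0)); rewrite -bopD !addr0. Qed.

Lemma bopZ T a f : T (a *: f) = a *: T f.
Proof. by rewrite -[a *: f in LHS]addr0 bop_linear bop0 addr0. Qed.

Fact bop_one_subproof : bounded_operator_on (@id H).
Proof.
by split=> //; [exists 1 => f; rewrite mul1r|exists id].
Qed.

Fact bop_mul_subproof T U : bounded_operator_on (fun f => T (U f)).
Proof.
have [_ [C hC] [T' hT]] := bopP T; have [_ [D hD] [U' hU]] := bopP U.
split=> [a f g||]; first by rewrite bopD !bopZ bopD bopZ.
- exists (`|C| * `|D|) => f; apply: le_trans (hC _) _.
  apply: (@le_trans _ _ (`|C| * l2norm (U f))).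
    by rewrite ler_wpM2r ?l2norm_ge0// ler_norm.
  rewrite -mulrA ler_wpM2l//; apply: le_trans (hD f) _.
  by rewrite ler_wpM2r ?l2norm_ge0// ler_norm.
- by exists (U' \o T') => f g; rewrite hT hU.
Qed.

Definition bop_one : bop := mk_bop bop_one_subproof.
Definition bop_mul T U : bop := mk_bop (bop_mul_subproof T U).

Fact dirac_square_summable :
  square_summable (fun s => if s == (point : S) then 1 else 0 : R[i]).
Proof.
exists 1 => F; rewrite /fset_sum.
rewrite (eq_bigr (fun s => if s == (point : S) then 1 else 0)); last first.
  by move=> s _; case: eqP => _; rewrite /rdot /= ?mulr1 ?mulr0 ?addr0.
rewrite -big_mkcond /= -big_filter big_const_seq iter_addr_0 count_predT size_filter.
by rewrite count_uniq_mem ?fset_uniq//; case: (_ \in _).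
Qed.

Fact bop_one_neq0 : bop_one != 0.
Proof.
apply/eqP => /(congr1 (fun T : bop => T (mk_l2 dirac_square_summable) point)) /=.
by rewrite eqxx => /eqP; rewrite oner_eq0.
Qed.

Fact bop_mulfE T U f : bop_mul T U f = T (U f).
Proof. by []. Qed.
Fact bop_mulA : associative bop_mul.
Proof. by move=> T U V; apply: bop_eq => f; rewrite !bop_mulfE. Qed.
Fact bop_mul1 : left_id bop_one bop_mul.
Proof. by move=> T; apply: bop_eq => f. Qed.
Fact bop_mulr1 : right_id bop_one bop_mul.
Proof. by move=> T; apply: bop_eq => f. Qed.
Fact bop_mulDl : left_distributive bop_mul +%R.
Proof. by move=> T U V; apply: bop_eq => f; rewrite bop_addE !bop_mulfE. Qed.
Fact bop_mulDr : right_distributive bop_mul +%R.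
Proof. by move=> T U V; apply: bop_eq => f; rewrite bop_addE !bop_mulfE bopD. Qed.

HB.instance Definition _ := GRing.Zmodule_isNzRing.Build bop
  bop_mulA bop_mul1 bop_mulr1 bop_mulDl bop_mulDr bop_one_neq0.

Fact bop_scaleAl (a : R[i]) T U : a *: (T * U) = (a *: T) * U.
Proof. by apply: bop_eq => f. Qed.

HB.instance Definition _ := GRing.Lmodule_isLalgebra.Build R[i] bop bop_scaleAl.

Fact bop_scaleAr (a : R[i]) T U : a *: (T * U) = T * (a *: U).
Proof. by apply: bop_eq => f; exact: (esym (bopZ T a (U f))). Qed.

HB.instance Definition _ := GRing.Lalgebra_isAlgebra.Build R[i] bop bop_scaleAr.

Lemma bop_mulE T U f : (T * U) f = T (U f). Proof. by []. Qed.
Lemma bop_oneE f : (1 : bop) f = f. Proof. by []. Qed.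

Definition bop_norm T : R := sup [set l2norm (T f) | f in [set f | l2norm f <= 1]].

Let bop_norm_has_sup T : has_sup [set l2norm (T f) | f in [set f | l2norm f <= 1]].
Proof.
split; first by exists (l2norm (T 0)); exists 0 => //=; rewrite l2norm0.
have [_ [C hC] _] := bopP T; exists `|C| => _ [f /= f1 <-].
apply: le_trans (hC f) _; apply: le_trans (ler_norm _) _.
by rewrite normrM [X in _ * X]ger0_norm ?l2norm_ge0// ler_piMr.
Qed.

Lemma bop_norm_ub T f : l2norm (T f) <= bop_norm T * l2norm f.
Proof.
have [f0|n0] := eqVneq (l2norm f) 0.
  by rewrite f0 mulr0 (l2norm_eq0 f0) bop0 l2norm0.
have fp : 0 < l2norm f by rewrite lt_neqAle eq_sym n0 l2norm_ge0.
rewrite -ler_pdivrMr//; apply: sup_ubound; first exact: (bop_norm_has_sup T).2.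
exists (((l2norm f)^-1)%:C%C *: f); rewrite /= ?bopZ l2normZ normc_real
  ger0_norm ?invr_ge0 ?l2norm_ge0//.
  by rewrite mulVf.
by rewrite mulrC.
Qed.

Lemma bop_norm_le T C : 0 <= C -> (forall f, l2norm (T f) <= C * l2norm f) ->
  bop_norm T <= C.
Proof.
move=> C0 hC; apply: ge_sup; first exact: (bop_norm_has_sup T).1.
by move=> _ [f /= f1 <-]; apply: le_trans (hC f) _; rewrite ler_piMr.
Qed.

Lemma bop_norm_ge0 T : 0 <= bop_norm T.
Proof.
apply: le_trans (l2norm_ge0 (T 0)) _; apply: sup_ubound; first exact: (bop_norm_has_sup T).2.
by exists 0 => //=; rewrite l2norm0.
Qed.

Fact bop_norm_eq0 T : bop_norm T = 0 -> T = 0.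
Proof.
move=> T0; apply: bop_eq => f; apply: l2norm_eq0; apply/eqP.
by rewrite eq_le l2norm_ge0 andbT; have := bop_norm_ub T f; rewrite T0 mul0r.
Qed.

Fact bop_normD T U : bop_norm (T + U) <= bop_norm T + bop_norm U.
Proof.
apply: bop_norm_le => [|f]; first by rewrite addr_ge0 ?bop_norm_ge0.
by rewrite bop_addE; apply: le_trans (l2normD _ _) _; rewrite mulrDl lerD ?bop_norm_ub.
Qed.

Fact bop_normZ (a : R[i]) T : (bop_norm (a *: T))%:C%C = `|a| * (bop_norm T)%:C%C.
Proof.
have le b U : bop_norm (b *: U) <= normc b * bop_norm U.
  apply: bop_norm_le => [|f]; first by rewrite mulr_ge0 ?normc_ge0 ?bop_norm_ge0.
  by rewrite bop_scaleE l2normZ -mulrA ler_wpM2l ?normc_ge0 ?bop_norm_ub.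
rewrite norm_complexE -rmorphM; congr (_%:C%C); apply/eqP; rewrite eq_le le/=.
have [->|a0] := eqVneq a 0.
  by rewrite ComplexField.Normc.normc0 mul0r bop_norm_ge0.
have na : 0 < normc a.
  rewrite lt_neqAle normc_ge0 andbT eq_sym; apply: contraNneq a0.
  by move=> /ComplexField.Normc.eq0_normc ->.
rewrite mulrC -ler_pdivlMr// mulrC -ComplexField.Normc.normcV.
by apply: le_trans (le _ _); rewrite scalerA mulVf// scale1r.
Qed.

Fact bop_normM T U : bop_norm (T * U) <= bop_norm T * bop_norm U.
Proof.
apply: bop_norm_le => [|f]; first by rewrite mulr_ge0 ?bop_norm_ge0.
rewrite bop_mulE; apply: le_trans (bop_norm_ub _ _) _.
by rewrite -mulrA ler_wpM2l ?bop_norm_ge0 ?bop_norm_ub.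
Qed.

Lemma rip_ext f g : (forall h, rip h f = rip h g) -> f = g.
Proof.
move=> fg; apply/eqP; rewrite -subr_eq0; apply/eqP; apply: rip_eq0.
by rewrite ripDr ripNr fg subrr.
Qed.

Definition bop_adjoint_fun T : H -> H := projT1 (cid (operator_adjoint (bopP T))).

Let adjE T f g : rip (T f) g = rip f (bop_adjoint_fun T g).
Proof. exact: (projT2 (cid (operator_adjoint (bopP T)))). Qed.

Let adj_norm T g : l2norm (bop_adjoint_fun T g) <= bop_norm T * l2norm g.
Proof.
set g' := bop_adjoint_fun T g.
have [g0|n0] := eqVneq (l2norm g') 0.
  by rewrite g0 mulr_ge0 ?bop_norm_ge0 ?l2norm_ge0.
have gp : 0 < l2norm g' by rewrite lt_neqAle eq_sym n0 l2norm_ge0.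
rewrite -(ler_pM2l gp) -expr2 l2norm_sqr {2}/g' -adjE.
apply: le_trans (rip_le_l2norm _ _) _; rewrite mulrCA mulrA ler_wpM2r ?l2norm_ge0//.
exact: bop_norm_ub.
Qed.

Fact bop_adjoint_subproof T : bounded_operator_on (bop_adjoint_fun T).
Proof.
split=> [a f g||]; last first.
- by exists T => f g; rewrite ripC -adjE ripC.
- by exists (bop_norm T) => f; exact: adj_norm.
apply: rip_ext => h; rewrite -adjE !ripDr -!adjE; congr (_ + _).
by rewrite !ripZr -bopZ adjE.
Qed.

Definition bop_adjoint T : bop := mk_bop (bop_adjoint_subproof T).

Lemma bop_adjointE T f g : rip (T f) g = rip f (bop_adjoint T g).
Proof. exact: adjE. Qed.

Lemma bop_adjoint_unique T U : (forall f g, rip (T f) g = rip f (U g)) ->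
  bop_adjoint T = U.
Proof. by move=> h; apply: bop_eq => g; apply: rip_ext => f; rewrite -h bop_adjointE. Qed.

Fact bop_adjointK : involutive bop_adjoint.
Proof. by move=> T; apply: bop_adjoint_unique => f g; rewrite ripC -bop_adjointE ripC. Qed.

Fact bop_adjointD : {morph bop_adjoint : T U / T + U}.
Proof.
by move=> T U; apply: bop_adjoint_unique => f g; rewrite !bop_addE ripDl ripDr !bop_adjointE.
Qed.

Fact bop_adjointZ (a : R[i]) T : bop_adjoint (a *: T) = a^* *: bop_adjoint T.
Proof.
apply: bop_adjoint_unique => f g.
by rewrite !bop_scaleE ripZl bop_adjointE bopZ.
Qed.

Fact bop_adjointM T U : bop_adjoint (T * U) = bop_adjoint U * bop_adjoint T.
Proof. by apply: bop_adjoint_unique => f g; rewrite !bop_mulE !bop_adjointE. Qed.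

Fact bop_norm_adjoint T : bop_norm (bop_adjoint T * T) = bop_norm T ^+ 2.
Proof.
apply/eqP; rewrite eq_le; apply/andP; split.
  apply: le_trans (bop_normM _ _) _; rewrite expr2 ler_wpM2r ?bop_norm_ge0//.
  by apply: bop_norm_le => [|f]; [exact: bop_norm_ge0|exact: adj_norm].
have N0 := bop_norm_ge0 (bop_adjoint T * T).
rewrite -(sqr_sqrtr N0) ler_pXn2r ?nnegrE ?bop_norm_ge0 ?sqrtr_ge0//.
apply: bop_norm_le => [|f]; first exact: sqrtr_ge0.
apply: l2norm_le; first by rewrite mulr_ge0 ?sqrtr_ge0 ?l2norm_ge0.
rewrite exprMn (sqr_sqrtr N0) bop_adjointE; apply: le_trans (rip_le_l2norm _ _) _.
rewrite mulrC expr2 mulrA ler_wpM2r ?l2norm_ge0//; exact: (bop_norm_ub (bop_adjoint T * T) f).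
Qed.

Lemma bop_norm_adj_le T : bop_norm (bop_adjoint T) <= bop_norm T.
Proof. by apply: bop_norm_le => [|f]; [exact: bop_norm_ge0|exact: adj_norm]. Qed.

Definition bop_cauchy (T : nat -> bop) : Prop :=
  forall e : R, 0 < e -> exists N : nat, forall m n : nat,
     (N <= m)%N -> (N <= n)%N -> bop_norm (T m - T n) < e.

(** Separate from the completeness of the operator algebra because it serves
    twice there: for a Cauchy sequence and for the sequence of its adjoints, whose
    limits turn out to be adjoint to each other. *)
Lemma bop_pointwise_limit (T : nat -> bop) : bop_cauchy T ->
  exists L : H -> H, [/\ linear L,
    exists C, forall f, l2norm (L f) <= C * l2norm f &
    forall e, 0 < e -> exists N : nat, forall n, (N <= n)%N ->
      forall f, l2norm (T n f - L f) <= e * l2norm f].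
Proof.
move=> cT.
have cTf e : 0 < e -> exists N : nat, forall m n : nat, (N <= m)%N -> (N <= n)%N ->
    forall f, l2norm (T m f - T n f) <= e * l2norm f.
  move=> e0; have [N hN] := cT e e0; exists N => m n Nm Nn f.
  apply: le_trans (bop_norm_ub (T m - T n) f) _.
  by rewrite ler_wpM2r ?l2norm_ge0// ltW// hN.
have /choice[L hL] : forall f, exists l : H, forall e : R, 0 < e ->
    exists N : nat, forall n, (N <= n)%N -> l2norm (T n f - l) <= e.
  move=> f; apply: l2_complete => e e0.
  have e1 : 0 < e / (l2norm f + 1) by rewrite divr_gt0// ltr_wpDl// l2norm_ge0.
  have [N hN] := cTf _ e1; exists N => m n Nm Nn; apply: le_lt_trans (hN m n Nm Nn f) _.
  by rewrite mulrAC ltr_pdivrMr ?ltr_wpDl ?l2norm_ge0// ltr_pM2l// ltrDl.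
have limL e : 0 < e -> exists N : nat, forall n, (N <= n)%N ->
    forall f, l2norm (T n f - L f) <= e * l2norm f.
  move=> e0; have [N hN] := cTf e e0; exists N => n Nn f.
  apply/ler_addgt0Pr => d d0; have [M /(_ (maxn M N) (leq_maxl _ _)) hM] := hL f d d0.
  have := hN n (maxn M N) Nn (leq_maxr _ _) f.
  have := l2normD (T n f - T (maxn M N) f) (T (maxn M N) f - L f).
  rewrite addrA subrK => /le_trans h hn; apply: h.
  by apply: le_trans (lerD hn hM) _.
have Leq f g : (forall e : R, 0 < e -> l2norm (f - g) <= e) -> f = g.
  move=> h; apply/eqP; rewrite -subr_eq0; apply/eqP/l2norm_eq0/eqP.
  rewrite eq_le l2norm_ge0 andbT; apply/ler_addgt0Pr => e /h; by rewrite add0r.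
have Llin : linear L.
  move=> a f g; apply: Leq => e e0.
  pose d := e / (2 + normc a).
  have a2 : 0 < 2 + normc a by rewrite ltr_wpDr// normc_ge0.
  have d0 : 0 < d by rewrite divr_gt0.
  have [N1 h1] := hL f d d0; have [N2 h2] := hL g d d0.
  have [N3 h3] := hL (a *: f + g) d d0.
  pose n := maxn N1 (maxn N2 N3).
  have k1 := h1 n (leq_maxl _ _).
  have k2 := h2 n (leq_trans (leq_maxl _ _) (leq_maxr _ _)).
  have k3 := h3 n (leq_trans (leq_maxr _ _) (leq_maxr _ _)).
  have -> : L (a *: f + g) - (a *: L f + L g) =
      a *: (T n f - L f) + (T n g - L g) - (T n (a *: f + g) - L (a *: f + g)).
    rewrite bop_linear scalerBr opprB [X in _ = X + _]addrACA -opprD.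
    by rewrite [RHS]addrC addrA subrK.
  have -> : e = normc a * d + d + d.
    by rewrite -addrA -mulr2n -mulr_natl -mulrDl addrC /d mulrCA mulfV ?mulr1// gt_eqF.
  apply: le_trans (l2normD _ _) _; rewrite l2normN; apply: lerD => //.
  apply: le_trans (l2normD _ _) _; rewrite l2normZ; apply: lerD => //.
  by rewrite ler_wpM2l// normc_ge0.
have [N1 /(_ N1 (leqnn _)) h1] := limL 1 ltr01.
exists L; split => //; exists (1 + bop_norm (T N1)) => f.
have := l2normD (L f - T N1 f) (T N1 f); rewrite subrK => /le_trans; apply.
by rewrite mulrDl; apply: lerD; [rewrite -l2normN opprB; exact: h1|exact: bop_norm_ub].
Qed.

Fact bop_complete (T : nat -> bop) : bop_cauchy T ->
  exists L : bop, bop_norm (T n - L) @[n --> \oo] --> (0 : R).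
Proof.
move=> cT; have [L [Llin Lbd hL]] := bop_pointwise_limit cT.
have cT' : bop_cauchy (bop_adjoint \o T).
  move=> e /cT[N hN]; exists N => m n Nm Nn /=; apply: le_lt_trans (hN m n Nm Nn).
  apply: le_trans (bop_norm_adj_le _).
  by rewrite bop_adjointD -[- T n]scaleN1r bop_adjointZ rmorphN1 scaleN1r.
have [L' [_ _ hL']] := bop_pointwise_limit cT'.
have Ladj_le f g : rip (L f) g - rip f (L' g) <= 0.
  pose K := l2norm f * l2norm g.
  have K0 : 0 <= K by rewrite mulr_ge0 ?l2norm_ge0.
  apply/ler_addgt0Pr => e e0; rewrite add0r.
  have d0 : 0 < e / (2 * K + 1) by rewrite divr_gt0// ltr_wpDl// mulr_ge0.
  set d := e / _ in d0.
  have [N hN] := hL _ d0; have [N' hN'] := hL' _ d0.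
  pose n := maxn N N'.
  have {hN} kN := hN n (leq_maxl _ _) f; have {hN'} kN' := hN' n (leq_maxr _ _) g.
  rewrite (_ : _ - _ = rip (L f - T n f) g + rip f (bop_adjoint (T n) g - L' g)); last first.
    by rewrite ripDl ripNl ripDr ripNr -bop_adjointE addrA subrK.
  apply: (@le_trans _ _ (d * K + d * K)).
    apply: lerD.
      apply: le_trans (rip_le_l2norm _ _) _; rewrite /K mulrA ler_wpM2r ?l2norm_ge0//.
      by rewrite -l2normN opprB.
    apply: le_trans (rip_le_l2norm _ _) _.
    by rewrite [leRHS]mulrCA ler_wpM2l ?l2norm_ge0.
  have K1 : 0 < 2 * K + 1 by rewrite ltr_wpDl// mulr_ge0.
  rewrite -mulrDr /d mulrAC ler_pdivrMr//. rewrite ler_pM2l//.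
  by rewrite mulr_natl mulr2n lerDl ler01.
have Ladj f g : rip (L f) g = rip f (L' g).
  have LN : L (- f) = - L f.
    have L0 : L 0 = 0.
      by have := Llin (-1) 0 0; rewrite scaler0 addr0 scaleN1r addNr.
    by rewrite -[- f]addr0 -[- f]scaleN1r Llin L0 addr0 scaleN1r.
  apply/eqP; rewrite -subr_eq0 eq_le Ladj_le/=.
  by have := Ladj_le (- f) g; rewrite LN !ripNl opprK addrC -oppr_ge0 opprB.
have hB : bounded_operator_on L by split=> //; exists L'.
exists (mk_bop hB); apply/cvgrPdist_le => e e0; have [N hN] := hL e e0.
exists N => // n Nn; rewrite /= sub0r normrN ger0_norm ?bop_norm_ge0//.
by apply: bop_norm_le => [|f]; [exact: ltW|exact: hN].
Qed.

HB.instance Definition _ := isCstar.Build R bop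
  bop_norm_eq0 bop_normD bop_normZ bop_normM bop_complete
  bop_adjointK bop_adjointD bop_adjointZ bop_adjointM bop_norm_adjoint.
End BoundedOperators.

(** * Existence of the UHF algebra *)

Section ConcreteOperators.
Variables (R : realType) (S : pointedType).
Local Notation H := (l2 R S).
Implicit Types f g : H.

Section Projection.
Variable p : pred S.

Fact restrict_square_summable f :
  square_summable (fun s => if p s then f s else 0 : R[i]).
Proof.
have [M hM] := l2P f; exists M => F; apply: le_trans (hM F).
apply: ler_sum => s _; case: (p s) => //.
by rewrite {1}/rdot /= !mulr0 addr0 rdot_ge0.
Qed.

Definition restrict_fun f : H := mk_l2 (restrict_square_summable f).

Lemma restrict_funE f s : restrict_fun f s = if p s then f s else 0.
Proof. by []. Qed.

Fact restrict_adjoint f g : rip (restrict_fun f) g = rip f (restrict_fun g).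
Proof.
rewrite /rip; congr unordered_sum; apply/funext => s; rewrite !restrict_funE.
by case: (p s) => //; rewrite /rdot /= !mulr0 !mul0r.
Qed.

Fact restrict_subproof : bounded_operator_on restrict_fun.
Proof.
split; last by exists restrict_fun; exact: restrict_adjoint.
  move=> a f g; apply: l2_eq => s.
  rewrite l2_addE l2_scaleE !restrict_funE l2_addE l2_scaleE.
  by case: (p s) => //; rewrite mulr0 addr0.
exists 1 => f; rewrite mul1r; apply: l2norm_le; first exact: l2norm_ge0.
rewrite l2norm_sqr; apply: rip_le => F; apply: le_trans (fset_sum_le_rip f F).
apply: ler_sum => s _; rewrite restrict_funE; case: (p s) => //.
by rewrite {1}/rdot /= !mulr0 addr0 rdot_ge0.
Qed.

Definition restrict_op : bop R S := mk_bop restrict_subproof.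

Lemma star_restrict_op : star restrict_op = restrict_op.
Proof. by apply: bop_adjoint_unique; exact: restrict_adjoint. Qed.

End Projection.

Section Involution.
Variables (tau : S -> S) (tauK : involutive tau).

Let fset_sum_comp (phi : S -> R) F :
  fset_sum (fun s => phi (tau s)) F = fset_sum phi [fset tau s | s in F]%fset.
Proof.
by rewrite /fset_sum big_imfset// => s t _ _; exact: inv_inj.
Qed.

Fact comp_square_summable f : square_summable (fun s => f (tau s)).
Proof.
have [M hM] := l2P f; exists M => F.
by rewrite (fset_sum_comp (fun s => rdot (f s) (f s))).
Qed.

Definition comp_fun f : H := mk_l2 (comp_square_summable f).

Lemma comp_funE f s : comp_fun f s = f (tau s). Proof. by []. Qed.

Let comp_funK f : comp_fun (comp_fun f) = f.
Proof. by apply: l2_eq => s; rewrite !comp_funE tauK. Qed.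

Let comp_fun_linear : linear comp_fun.
Proof. by move=> a f g; apply: l2_eq => s. Qed.

Let rip_comp_le f : rip (comp_fun f) (comp_fun f) <= rip f f.
Proof.
apply: rip_le => F.
rewrite (fset_sum_comp (fun s => rdot (f s) (f s))); exact: fset_sum_le_rip.
Qed.

Let rip_comp_diag f : rip (comp_fun f) (comp_fun f) = rip f f.
Proof.
by apply/eqP; rewrite eq_le rip_comp_le -{1 2}(comp_funK f) rip_comp_le.
Qed.

Let rip_polar f g : rip f g = 4^-1 * (rip (f + g) (f + g) - rip (f - g) (f - g)).
Proof.
rewrite !(ripDl, ripDr, ripNl, ripNr) (ripC g f).
by move: (rip f f) (rip g g) (rip f g) => x y z; field.
Qed.

Fact comp_adjoint f g : rip (comp_fun f) g = rip f (comp_fun g).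
Proof.
have cD h k : comp_fun h + comp_fun k = comp_fun (h + k) by apply: l2_eq.
have cB h k : comp_fun h - comp_fun k = comp_fun (h - k) by apply: l2_eq.
by rewrite -{1}(comp_funK g) rip_polar cD cB !rip_comp_diag -rip_polar.
Qed.

Fact comp_subproof : bounded_operator_on comp_fun.
Proof.
split=> //; last by exists comp_fun; exact: comp_adjoint.
by exists 1 => f; rewrite mul1r /l2norm rip_comp_diag.
Qed.

Definition comp_op : bop R S := mk_bop comp_subproof.

Lemma star_comp_op : star comp_op = comp_op.
Proof. by apply: bop_adjoint_unique; exact: comp_adjoint. Qed.

End Involution.
End ConcreteOperators.

Section CommutingUnits.
Variable R : realType.

(** Another presentation of an infinite tensor power of matrix algebras, by
    matrix units of its factors: rows and columns are indexed by an arbitrary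
    finite type, to be able to let a group act on them. *)
Record commuting_units (I : finType) (A : cstarType R)
    (e : nat -> I -> I -> A) : Prop := {
  unitsM : forall i a b c d, e i a b * e i c d = if b == c then e i a d else 0;
  units1 : forall i, \sum_a e i a a = 1;
  units_star : forall i a b, star (e i a b) = e i b a;
  unitsC : forall i k a b c d, i <> k -> e i a b * e k c d = e k c d * e i a b;
  units_generate : forall S : set A, closed_star_subalgebra S ->
    (forall i a b, S (e i a b)) -> S = setT
}.

Lemma commuting_units_UHF (I : finType) (A : cstarType R) (e : nat -> I -> I -> A) :
  commuting_units e -> is_UHF_infty #|I| A.
Proof.
move=> he.
pose j i (X : 'M[R[i]]_#|I|) : A :=
  \sum_(p : I * I) X (enum_rank p.1) (enum_rank p.2) *: e i p.1 p.2.
have jE i X : j i X = \sum_a \sum_b X (enum_rank a) (enum_rank b) *: e i a b.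
  by rewrite /j -(pair_bigA _ (fun a b => X (enum_rank a) (enum_rank b) *: e i a b)).
exists j; split.
- move=> i; split.
  + move=> a X Y; rewrite /j scaler_sumr -big_split; apply: eq_bigr => p _ /=.
    by rewrite !mxE scalerDl scalerA.
  + move=> X Y; rewrite !jE big_distrl; apply: eq_bigr => a _ /=.
    rewrite big_distrl /=.
    under [RHS]eq_bigr => b _.
      rewrite big_distrr /= (bigD1 b)//= [X in _ + X]big1 ?addr0; last first.
        move=> c cb; rewrite big_distrr big1// => d _ /=.
        by rewrite -scalerAr -scalerAl (unitsM he) eq_sym (negbTE cb) !scaler0.
      rewrite big_distrr /=.
      under eq_bigr => d _ do rewrite -scalerAr -scalerAl (unitsM he) eqxx scalerA mulrC.
      over.
    rewrite exchange_big /=; apply: eq_bigr => d _.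
    rewrite -scaler_suml mxE; congr (_ *: _).
    rewrite (reindex enum_rank) //=.
    by exists enum_val => ? _; [exact: enum_rankK|exact: enum_valK].
  + rewrite jE -(units1 he i); apply: eq_bigr => a _.
    rewrite (bigD1 a)//= big1 ?addr0 => [|b ba]; first by rewrite mxE eqxx scale1r.
    by rewrite mxE (inj_eq enum_rank_inj) eq_sym (negbTE ba) scale0r.
  + move=> X; rewrite !jE star_sum exchange_big /=; apply: eq_bigr => a _.
    rewrite star_sum; apply: eq_bigr => b _.
    by rewrite starZ (units_star he) !mxE.
- move=> i k X Y ik; rewrite /j [LHS]mulr_suml [RHS]mulr_sumr; apply: eq_bigr => p _.
  rewrite mulr_sumr mulr_suml; apply: eq_bigr => q _.
  by rewrite -!scalerAr -!scalerAl (unitsC he)// !scalerA mulrC.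
- move=> S Sc Sa Sj; apply: (units_generate he) => // i a b.
  have -> : e i a b = j i (delta_mx (enum_rank a) (enum_rank b)); last exact: Sj.
  rewrite /j (bigD1 (a, b))//= big1 ?addr0 => [|[c d] cd]; first by rewrite mxE !eqxx scale1r.
  rewrite /= mxE !(inj_eq enum_rank_inj).
  by move: cd; rewrite xpair_eqE => /negbTE ->; rewrite scale0r.
Qed.

Lemma UHF_commuting_units (I : finType) (A : cstarType R) :
  is_UHF_infty #|I| A -> exists e : nat -> I -> I -> A, commuting_units e.
Proof.
case=> j [jh jC jgen].
have jL i := matrix_star_hom_linear (jh i).
have j0 i : j i 0 = 0.
  by have := jL i (-1) 0 0; rewrite scaler0 addr0 scaleN1r addNr.
have jZ i a X : j i (a *: X) = a *: j i X by rewrite -[a *: X]addr0 jL j0 addr0.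
have jD i X Y : j i (X + Y) = j i X + j i Y by rewrite -[X in LHS]scale1r jL scale1r.
pose u (a b : I) : 'M[R[i]]_#|I| := delta_mx (enum_rank a) (enum_rank b).
exists (fun i a b => j i (u a b)); split.
- move=> i a b c d; rewrite -(matrix_star_homM (jh i)) /u.
  case: eqP => [->|bc]; first by rewrite mul_delta_mx.
  by rewrite mul_delta_mx_0 ?j0// (inj_eq enum_rank_inj); apply/eqP.
- move=> i; rewrite -(big_morph (j i) (jD i) (j0 i)) -(matrix_star_hom1 (jh i)); congr j.
  apply/matrixP => x y; rewrite summxE mxE (bigD1 (enum_val x))//= big1 ?addr0.
    by rewrite mxE !enum_valK eqxx /= eq_sym.
  move=> a ax; rewrite mxE; case: eqP => //= xa; move: ax.
  by rewrite xa enum_rankK eqxx.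
- move=> i a b; rewrite -(matrix_star_hom_star (jh i)); congr j.
  apply/matrixP => x y; rewrite !mxE andbC.
  by case: (_ && _); rewrite ?rmorph1 ?rmorph0.
- by move=> i k a b c d ik; exact: jC.
- move=> S [Sa Sc] Su; apply: jgen => // i X.
  rewrite (matrix_sum_delta X) (big_morph (j i) (jD i) (j0 i)).
  apply: (star_subalgebra_sum Sa) => x _.
  rewrite (big_morph (j i) (jD i) (j0 i)); apply: (star_subalgebra_sum Sa) => y _.
  rewrite jZ; apply: (star_subalgebraZ Sa).
  by rewrite -(enum_valK x) -(enum_valK y); exact: Su.
Qed.

End CommutingUnits.

(** The UHF algebra is realized on the Hilbert space with an orthonormal basis
    indexed by the infinite words in the letters of [G], the [i]-th tensor factor
    acting on the [i]-th letter. The matrix units are products of a projection and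
    of a self-adjoint unitary that swaps two values of a letter, so that
    boundedness and adjoints come for free. *)
Section Existence.
Variables (R : realType) (G : finGroupType).

Definition words : Type := nat -> G.
HB.instance Definition _ := Choice.on words.
HB.instance Definition _ := isPointed.Build words (fun=> 1%g : G).

Implicit Types (x : words) (a b c d : G) (i k : nat).
Local Notation B := (bop R words).

Definition upd x i a : words := fun k => if k == i then a else x k.

Lemma upd_same x i a b : upd (upd x i a) i b = upd x i b.
Proof. by apply/funext => k; rewrite /upd; case: eqP. Qed.

Lemma upd_eq x i a : upd x i a i = a.
Proof. by rewrite /upd eqxx. Qed.

Lemma upd_neq x i k a : i <> k -> upd x i a k = x k.
Proof. by rewrite /upd; case: eqP => // -> /(_ erefl). Qed.

Lemma upd_id x i : upd x i (x i) = x.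
Proof. by apply/funext => k; rewrite /upd; case: eqP => // ->. Qed.

Lemma updC x i k a b : i <> k -> upd (upd x i a) k b = upd (upd x k b) i a.
Proof.
move=> ik; apply/funext => m; rewrite /upd.
by case: (m =P k) => // mk; case: (m =P i) => // mi; case: ik; rewrite -mi -mk.
Qed.

Definition swap_letter i a b x : words := upd x i (tperm a b (x i)).

Lemma swap_letterK i a b : involutive (swap_letter i a b).
Proof. by move=> x; rewrite /swap_letter upd_eq upd_same tpermK upd_id. Qed.

Definition unit_op i a b : B :=
  restrict_op R (fun x => x i == a) * comp_op R (@swap_letterK i a b).

Lemma unit_opE i a b (f : l2 R words) x :
  unit_op i a b f x = if x i == a then f (upd x i b) else 0.
Proof.
rewrite [LHS](_ : _ = if x i == a then f (swap_letter i a b x) else 0)//.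
by case: eqP => // <-; rewrite /swap_letter tpermL.
Qed.

Lemma bop_sumE (T : finType) (F : T -> B) (f : l2 R words) x :
  (\sum_t F t) f x = \sum_t F t f x.
Proof. exact: (big_morph (fun U : B => U f x) (fun U V => erefl) erefl). Qed.

Lemma bop_eqP (T U : B) : (forall f x, T f x = U f x) -> T = U.
Proof. by move=> TU; apply: bop_eq => f; exact: l2_eq. Qed.

Lemma unit_opM i a b c d :
  unit_op i a b * unit_op i c d = if b == c then unit_op i a d else 0.
Proof.
apply: bop_eqP => f x; rewrite bop_mulE unit_opE unit_opE upd_eq upd_same.
by case: (b == c); rewrite ?unit_opE //; case: (x i == a).
Qed.

Lemma unit_op1 i : \sum_a unit_op i a a = 1.
Proof.
apply: bop_eqP => f x; rewrite bop_sumE bop_oneE (bigD1 (x i))// big1.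
  by rewrite unit_opE eqxx upd_id; exact: addr0.
by move=> a; rewrite andTb => ax; rewrite unit_opE eq_sym (negbTE ax).
Qed.

Lemma unit_op_star i a b : star (unit_op i a b) = unit_op i b a.
Proof.
rewrite starM star_restrict_op star_comp_op; apply: bop_eqP => f x; rewrite unit_opE.
rewrite [LHS](_ : _ = if swap_letter i a b x i == a then f (swap_letter i a b x) else 0)//.
have e : (tperm a b (x i) == a) = (x i == b).
  by rewrite -[X in _ == X](tpermR a b) (inj_eq perm_inj).
rewrite /swap_letter upd_eq e.
by case: eqP => // ->; rewrite tpermR.
Qed.

Lemma unit_opC i k a b c d : i <> k ->
  unit_op i a b * unit_op k c d = unit_op k c d * unit_op i a b.
Proof.
move=> ik; have ki : k <> i by exact/nesym.
apply: bop_eqP => f x; rewrite !bop_mulE 4!unit_opE !upd_neq// updC//.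
by case: eqP; case: eqP.
Qed.

(** In this form, the C*-algebra generated by the matrix units is closed, and has
    no smaller closed subalgebra containing them, for formal reasons. *)
Definition generated_by_units : set B := [set y | forall S, closed_star_subalgebra S ->
  (forall i a b, S (unit_op i a b)) -> S y].

Lemma generated_by_units_closed : closed_star_subalgebra generated_by_units.
Proof.
split; first split.
- by move=> S [hS _] _; exact: star_subalgebra1.
- by move=> z x y hx hy S hS uS; apply: (star_subalgebraP hS.1); [exact: hx|exact: hy].
- by move=> x y hx hy S hS uS; apply: (star_subalgebraM hS.1); [exact: hx|exact: hy].
- by move=> x hx S hS uS; apply: (star_subalgebra_star hS.1); exact: hx.
- by move=> x l hx xl S hS uS; apply: hS.2 xl => n; exact: hx.
Qed.

Definition UHF_sub : cstar_sub B := CstarSub generated_by_units_closed.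

Lemma UHF_exists : exists A : cstarType R, is_UHF_infty #|G| A.
Proof.
exists (cstar_sub_type UHF_sub).
have ue i a b : cstar_sub_set UHF_sub (unit_op i a b) by move=> S _; exact.
apply: (@commuting_units_UHF _ _ _ (fun i a b => cstar_in (ue i a b))); split.
- move=> i a b c d; apply: cstar_val_inj; rewrite [LHS]unit_opM; by case: eqP.
- move=> i; apply: cstar_val_inj; rewrite -[RHS](unit_op1 i).
  exact: (big_morph (@cstar_val R B UHF_sub) (fun y z => erefl) erefl).
- by move=> i a b; apply: cstar_val_inj; exact: unit_op_star.
- by move=> i k a b c d ik; apply: cstar_val_inj; exact: unit_opC.
- move=> S [Sa Sc] Su; apply/seteqP; split => // y _.
  (* A closed subalgebra of the subalgebra is closed in the large algebra. *)
  pose S' : set B := [set z | exists2 y, S y & cstar_val y = z].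
  suff : S' (cstar_val y) by case=> z Sz /cstar_val_inj <-.
  apply: (cstar_valP y); last by move=> i a b; exists (cstar_in (ue i a b)).
  split; first split.
  + by exists 1 => //; exact: (star_subalgebra1 Sa).
  + by move=> a _ _ [z Sz <-] [w Sw <-]; exists (a *: z + w) => //; exact: (star_subalgebraP Sa).
  + by move=> _ _ [z Sz <-] [w Sw <-]; exists (z * w) => //; exact: (star_subalgebraM Sa).
  + by move=> _ [z Sz <-]; exists (star z) => //; exact: (star_subalgebra_star Sa).
  + move=> x l hx xl.
    have Bl : cstar_sub_set UHF_sub l.
      by apply: (cstar_subP UHF_sub).2 xl => n; have [z _ <-] := hx n; exact: cstar_valP.
    have /choice[z hz] : forall n, exists z, S z /\ cstar_val z = x n.
      by move=> n; have [z ? ?] := hx n; exists z.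
    exists (cstar_in Bl) => //; apply: (Sc z) => [n|]; first exact: (hz n).1.
    have xE : x = fun n => cstar_val (z n) by apply/funext => n; rewrite (hz n).2.
    by rewrite xE in xl; exact: xl.
Qed.

End Existence.

(** * Matrix units and finite tensor products *)

Section Units.
Variables (R : realType) (I : finType) (A : cstarType R) (e : nat -> I -> I -> A).
Hypothesis he : commuting_units e.
Implicit Types (x y : A) (a b c d : I) (i k n : nat) (f g : I -> R[i]).

Definition diag i f : A := \sum_a f a *: e i a a.

Lemma unit_diag i a b f : e i a b * diag i f = f b *: e i a b.
Proof.
rewrite /diag mulr_sumr (bigD1 b)//= big1 ?addr0 => [|c cb].
  by rewrite -scalerAr (unitsM he) eqxx.
by rewrite -scalerAr (unitsM he) eq_sym (negbTE cb) scaler0.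
Qed.

Lemma diag_unit i a b f : diag i f * e i a b = f a *: e i a b.
Proof.
rewrite /diag mulr_suml (bigD1 a)//= big1 ?addr0 => [|c cb].
  by rewrite -scalerAl (unitsM he) eqxx.
by rewrite -scalerAl (unitsM he) (negbTE cb) scaler0.
Qed.

Lemma diagM i f g : diag i f * diag i g = diag i (fun a => f a * g a).
Proof.
rewrite {2}/diag mulr_sumr; apply: eq_bigr => a _.
by rewrite -scalerAr diag_unit scalerA mulrC.
Qed.

Lemma diag_cst i (z : R[i]) : diag i (fun=> z) = z *: 1.
Proof. by rewrite /diag -scaler_sumr (units1 he). Qed.

Lemma diag_star i f : star (diag i f) = diag i (fun a => (f a)^*).
Proof. by rewrite star_sum; apply: eq_bigr => a _; rewrite starZ (units_star he). Qed.

Lemma unit_as_diag i a : e i a a = diag i (fun c => (c == a)%:R).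
Proof.
rewrite /diag (bigD1 a)//= big1 ?addr0 => [|b ba]; first by rewrite eqxx scale1r.
by rewrite (negbTE ba) scale0r.
Qed.

Lemma eq_diag i f g : f =1 g -> diag i f = diag i g.
Proof. by move=> /funext ->. Qed.

Lemma diag_comm i f x : (forall a, e i a a * x = x * e i a a) -> diag i f * x = x * diag i f.
Proof.
move=> ex; rewrite /diag mulr_suml mulr_sumr; apply: eq_bigr => a _.
by rewrite -scalerAl -scalerAr ex.
Qed.

Lemma unit_diagC i k a f : e i a a * diag k f = diag k f * e i a a.
Proof.
have [->|/eqP ik] := eqVneq i k; first by rewrite unit_diag diag_unit.
by rewrite diag_comm// => b; rewrite (unitsC he)//; exact/nesym.
Qed.

Lemma diag_unitary i f : (forall a, `|f a| = 1) -> unitary (diag i f).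
Proof.
move=> f1; rewrite /unitary diag_star !diagM.
have e1 : (fun a => (f a)^* * f a) =1 fun=> 1 by move=> a; rewrite mul_conjC_unit.
have e2 : (fun a => f a * (f a)^*) =1 fun=> 1 by move=> a; rewrite mulrC mul_conjC_unit.
by rewrite (eq_diag _ e1) (eq_diag _ e2) diag_cst scale1r.
Qed.

(** The [(a, b)] entry of [x], viewed as a matrix over the relative commutant
    of the [n]-th tensor factor. *)
Definition coef n a b x : A := \sum_c e n c a * x * e n b c.

Lemma coef_linear n a b : linear (coef n a b).
Proof.
move=> z x y; rewrite /coef scaler_sumr -big_split; apply: eq_bigr => c _ /=.
by rewrite mulrDr mulrDl -scalerAr -scalerAl.
Qed.

Lemma coef_star n a b x : coef n a b (star x) = star (coef n b a x).
Proof.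
rewrite /coef star_sum; apply: eq_bigr => c _.
by rewrite !starM !(units_star he) mulrA.
Qed.

(** This is the product of matrices. It holds for arbitrary [x] and [y], since
    [A] is the algebra of matrices over the relative commutant of any of its
    tensor factors. *)
Lemma coefM n a b x y : coef n a b (x * y) = \sum_c coef n a c x * coef n c b y.
Proof.
under [RHS]eq_bigr => c _.
  rewrite /coef mulr_suml.
  under eq_bigr => d _.
    rewrite mulr_sumr (bigD1 d)//= big1 ?addr0 => [|d' d'd]; last first.
      by rewrite -!mulrA [e n c d * _]mulrA (unitsM he) eq_sym (negbTE d'd) mul0r !mulr0.
    rewrite -!mulrA [e n c d * _]mulrA (unitsM he) eqxx.
    over.
  over.
rewrite exchange_big /=; apply: eq_bigr => d _.
rewrite -!mulrA -mulr_sumr -mulr_sumr -mulr_suml (units1 he) mul1r.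
by [].
Qed.

Lemma coef_reconstruct n x : \sum_a \sum_b coef n a b x * e n a b = x.
Proof.
rewrite -[RHS]mul1r -[RHS]mulr1 -{1}(units1 he n) -(units1 he n) !mulr_suml.
apply: eq_bigr => a _; rewrite mulr_sumr; apply: eq_bigr => b _.
rewrite /coef mulr_suml (bigD1 a)//= big1 ?addr0 => [|c ca].
  by rewrite -!mulrA (unitsM he) eqxx.
by rewrite -!mulrA (unitsM he) (negbTE ca) !mulr0.
Qed.

Lemma coef_comm n a b x : (forall c d, x * e n c d = e n c d * x) ->
  coef n a b x = if a == b then x else 0.
Proof.
move=> xe; rewrite /coef.
under eq_bigr => c _ do rewrite -xe -mulrA (unitsM he).
case: eqP => _; first by rewrite -mulr_sumr (units1 he) mulr1.
by rewrite big1// => c _; rewrite mulr0.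
Qed.

Lemma coef_unit n a b c d :
  coef n a b (e n c d) = if (a == c) && (d == b) then 1 else 0.
Proof.
rewrite /coef; under eq_bigr => k _ do rewrite (unitsM he).
case: eqP => _ /=; last by rewrite big1// => k _; rewrite mul0r.
under eq_bigr => k _ do rewrite (unitsM he).
case: eqP => _ /=; first exact: units1.
by rewrite big1.
Qed.

Lemma coef_tends n a b (x : nat -> A) l :
  tends x l -> tends (fun m => coef n a b (x m)) (coef n a b l).
Proof.
move=> xl; rewrite /coef; elim: (index_enum I) => [|c r ih].
  by apply: (@tends_near _ _ _ _ 0%N) => m _; rewrite !big_nil.
under eq_fun do rewrite big_cons.
rewrite big_cons; apply: tendsD ih.
have cst z : tends (fun=> z : A) z by apply: (@tends_near _ _ _ _ 0%N).
by apply: tendsM (cst _); exact: tendsM (cst _) xl.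
Qed.

(** The tensor product of the factors [0, ..., n - 1]. Characterizing it by
    coefficients rather than as a linear span makes closedness an immediate
    consequence of the continuity of coefficients. *)
Fixpoint head_factors n : set A :=
  if n is m.+1 then [set x | forall a b, head_factors m (coef m a b x)]
  else [set x | exists z : R[i], x = z *: 1].

Lemma scalars_closed : closed_star_subalgebra (head_factors 0).
Proof.
split; first split => /=.
- by exists 1; rewrite scale1r.
- by move=> z _ _ [x ->] [y ->]; exists (z * x + y); rewrite scalerDl scalerA.
- by move=> _ _ [x ->] [y ->]; exists (x * y); rewrite -scalerAl -scalerAr mulr1 scalerA.
- by move=> _ [x ->]; exists (x^*); rewrite starZ star1.
- move=> x l /choice[z hz] xl.
  have zz m k : normc (z m - z k) = cnorm (x m - x k).
    by rewrite (hz m) (hz k) -scalerBl cnormZr cnorm1 mulr1.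
  have [|z0 hz0] := @complex_complete _ z.
    move=> r r0; have [|N hN] := (null_seqP _).1 xl (r / 2); first by rewrite divr_gt0.
    exists N => m k Nm Nk; rewrite zz.
    have := cnormB (x m - l) (x k - l); have := hN m Nm; have := hN k Nk.
    rewrite opprB addrA subrK; lra.
  exists z0; apply: tends_unique xl _.
  apply: (@null_seq_le _ _ (fun m => normc (z m - z0))) => // m.
  by rewrite (hz m) -scalerBl cnormZr cnorm1 mulr1.
Qed.

Lemma head_closed n : closed_star_subalgebra (head_factors n).
Proof.
elim: n => [|n [hS hc]]; first exact: scalars_closed.
split; first split => /=.
- move=> a b; rewrite coef_comm; last by move=> c d; rewrite mul1r mulr1.
  by case: eqP => _; [exact: star_subalgebra1|exact: star_subalgebra0].
- move=> z x y hx hy a b; rewrite coef_linear.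
  exact: (star_subalgebraP hS).
- move=> x y hx hy a b; rewrite coefM; apply: (star_subalgebra_sum hS) => c _.
  exact: (star_subalgebraM hS).
- by move=> x hx a b; rewrite coef_star; exact: (star_subalgebra_star hS).
- by move=> x l hx xl a b; apply: hc (coef_tends n a b xl) => m; exact: hx.
Qed.

Lemma head_comm n x i c d : head_factors n x -> (n <= i)%N -> x * e i c d = e i c d * x.
Proof.
elim: n x => [|n ih] x.
  by case=> z -> _; rewrite -scalerAl -scalerAr mul1r mulr1.
move=> /= hx ni; rewrite -(coef_reconstruct n x) mulr_suml mulr_sumr.
apply: eq_bigr => a _; rewrite mulr_suml mulr_sumr; apply: eq_bigr => b _.
rewrite -mulrA (unitsC he) ?mulrA ?ih// ?(ltnW ni)//.
by move=> ni'; rewrite ni' ltnn in ni.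
Qed.

Lemma headS n x : head_factors n x -> head_factors n.+1 x.
Proof.
move=> hx a b; rewrite coef_comm; last by move=> c d; exact: (head_comm c d hx).
by case: eqP => _ //; exact: star_subalgebra0 (head_closed n).1.
Qed.

Lemma head_unit n a b : head_factors n.+1 (e n a b).
Proof.
move=> c d; rewrite coef_unit; have hS := (head_closed n).1.
by case: ifP => _; [exact: star_subalgebra1|exact: star_subalgebra0].
Qed.

Definition spanned (S : set A) : Prop := exists (J : finType) (v : J -> A),
  (forall j, S (v j)) /\ forall x, S x -> exists z : J -> R[i], x = \sum_j z j *: v j.

Lemma head_spanned n : spanned (head_factors n).
Proof.
elim: n => [|n [J [v [hv sv]]]].
  exists unit, (fun=> 1); split; first by move=> _; exact: star_subalgebra1 scalars_closed.1.
  by move=> _ [z ->]; exists (fun=> z); rewrite (big_pred1 tt)//; case.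
exists (J * (I * I))%type, (fun p => v p.1 * e n p.2.1 p.2.2); split.
  move=> [j [a b]] /=; apply: (star_subalgebraM (head_closed n.+1).1).
    exact: headS.
  exact: head_unit.
move=> x hx.
have /choice[z hz] : forall p : I * I, exists z : J -> R[i],
    coef n p.1 p.2 x = \sum_j z j *: v j by move=> p; exact/sv/hx.
exists (fun p => z p.2 p.1).
rewrite -(pair_bigA _ (fun j p => z p j *: (v j * e n p.1 p.2))) /= exchange_big /=.
rewrite -[LHS](coef_reconstruct n) pair_big /=; apply: eq_bigr => p _.
by rewrite (hz p) mulr_suml; apply: eq_bigr => j _; rewrite scalerAl.
Qed.

(** The tensor product of the factors [0, ..., n - 1] with the diagonal
    subalgebra of the factor [n]. Automorphisms of a full matrix algebra are
    inner, so that the anomaly of an action on it is a coboundary; the center of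
    [level n], the diagonal of the last factor, leaves room for other anomalies. *)
Definition level n : set A :=
  head_factors n.+1 `&` [set x | forall y, range (fun a => e n a a) y -> x * y = y * x].

Lemma level_closed n : closed_star_subalgebra (level n).
Proof.
apply: closed_star_subalgebraI; first exact: head_closed.
by apply: closed_star_commutant => _ [a _ <-]; exists a => //; rewrite (units_star he).
Qed.

Lemma level_diag_comm n x a : level n x -> x * e n a a = e n a a * x.
Proof. by case=> _; apply; exists a. Qed.

Lemma level_head_comm n x i a b : level n x -> (n < i)%N -> x * e i a b = e i a b * x.
Proof. by case=> hx _; exact: head_comm. Qed.

Lemma headS_level n x : head_factors n x -> level n x.
Proof.
by move=> hx; split; [exact: headS|move=> _ [a _ <-]; exact: (head_comm a a hx)].
Qed.

Lemma levelS n x : level n x -> level n.+1 x.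
Proof. by case=> hx _; exact: headS_level. Qed.

Lemma level_unit n a b : level n.+1 (e n a b).
Proof. by apply: headS_level; exact: head_unit. Qed.

Lemma level_diag n f : level n (diag n f).
Proof.
split; last by move=> _ [a _ <-]; rewrite unit_diagC.
apply: (star_subalgebra_sum (head_closed n.+1).1) => a _.
by apply: (star_subalgebraZ (head_closed n.+1).1); exact: head_unit.
Qed.

Lemma level_dense (S : set A) : closed_star_subalgebra S ->
  (forall n x, level n x -> S x) -> S = setT.
Proof.
by move=> Sc hS; apply: (units_generate he) => // i a b; exact: hS (level_unit i a b).
Qed.

(** Compressing by the diagonal projections of the factor [n] maps
    [head_factors n.+1] onto [level n] and fixes the latter. *)
Lemma level_spanned n : spanned (level n).
Proof.
have [J [v [hv sv]]] := head_spanned n.+1.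
pose E x := \sum_a e n a a * x * e n a a.
exists J, (fun j => E (v j)); split.
  move=> j; split.
    apply: (star_subalgebra_sum (head_closed n.+1).1) => a _.
    apply: (star_subalgebraM (head_closed n.+1).1); last exact: head_unit.
    by apply: (star_subalgebraM (head_closed n.+1).1) => //; exact: head_unit.
  move=> _ [a _ <-]; rewrite /E mulr_suml mulr_sumr (bigD1 a)//= [RHS](bigD1 a)//=.
  rewrite !big1 ?addr0; last 2 first.
  - by move=> b ba; rewrite !mulrA (unitsM he) eq_sym (negbTE ba) !mul0r.
  - by move=> b ba; rewrite -!mulrA (unitsM he) (negbTE ba) !mulr0.
  by rewrite -!mulrA (unitsM he) eqxx !mulrA (unitsM he) eqxx.
move=> x hx; have [z xz] := sv x hx.1; exists z.
have -> : x = E x.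
  rewrite /E; under eq_bigr => a _ do rewrite -(level_diag_comm a hx) -mulrA (unitsM he) eqxx.
  by rewrite -mulr_sumr (units1 he) mulr1.
rewrite {1}xz /E; under eq_bigr => a _ do rewrite mulr_sumr mulr_suml.
rewrite exchange_big; apply: eq_bigr => j _; rewrite scaler_sumr; apply: eq_bigr => a _.
by rewrite -scalerAr -scalerAl.
Qed.

End Units.

(** * Implementing unitaries *)

Section Implementing.
Variables (R : realType) (G : finGroupType) (A : cstarType R) (e : nat -> G -> G -> A).
Hypothesis he : commuting_units e.
Local Notation diag := (diag e).
Local Notation level := (level e).
Local Notation head_factors := (head_factors e).
Implicit Types (x y W : A) (a b c d g h k : G) (i n m : nat) (phi psi : G -> G -> R[i]).

Lemma unit_unitC (i k : nat) a b : e i a a * e k b b = e k b b * e i a a.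
Proof.
have [->|/eqP ik] := eqVneq i k; last exact: (unitsC he).
by rewrite !(unitsM he) eq_sym; case: eqP => // ->.
Qed.

(** The left regular representation of [G] in the [i]-th tensor factor. *)
Definition regular i g : A := \sum_a e i (g * a)%g a.

Lemma regular_unit i g a b : regular i g * e i a b = e i (g * a)%g b.
Proof.
rewrite /regular mulr_suml (bigD1 a)//= big1 ?addr0 => [|c ca].
  by rewrite (unitsM he) eqxx.
by rewrite (unitsM he) (negbTE ca).
Qed.

Lemma unit_regular i g a b : e i a (g * b)%g * regular i g = e i a b.
Proof.
rewrite /regular mulr_sumr (bigD1 b)//= big1 ?addr0 => [|c cb].
  by rewrite (unitsM he) eqxx.
by rewrite (unitsM he) (inj_eq (mulgI g)) eq_sym (negbTE cb).
Qed.

Lemma regularM i g h : regular i g * regular i h = regular i (g * h)%g.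
Proof.
rewrite {2}/regular mulr_sumr; apply: eq_bigr => a _.
by rewrite regular_unit mulgA.
Qed.

Lemma regular1 i : regular i 1%g = 1.
Proof. by rewrite -(units1 he i); apply: eq_bigr => a _; rewrite mul1g. Qed.

Lemma regular_star i g : star (regular i g) = regular i g^-1%g.
Proof.
rewrite star_sum /regular [RHS](reindex_inj (mulgI g)) /=; apply: eq_bigr => a _.
by rewrite (units_star he) mulKg.
Qed.

Lemma regular_unitary i g : unitary (regular i g).
Proof.
by rewrite /unitary regular_star !regularM mulVg mulgV regular1.
Qed.

Lemma regular_comm i g x : (forall a b, e i a b * x = x * e i a b) ->
  regular i g * x = x * regular i g.
Proof.
by move=> ex; rewrite /regular mulr_suml mulr_sumr; apply: eq_bigr => a _; exact: ex.
Qed.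

(** The diagonal operator with symbol [phi] in the factors [n] and [n + 1]. *)
Definition phase n phi : A := \sum_a \sum_b phi a b *: (e n a a * e n.+1 b b).

Lemma phase_diag n phi : phase n phi = \sum_a e n a a * diag n.+1 (phi a).
Proof.
by apply: eq_bigr => a _; rewrite mulr_sumr; apply: eq_bigr => b _; rewrite -scalerAr.
Qed.

Lemma phaseM n phi psi : phase n phi * phase n psi = phase n (fun a b => phi a b * psi a b).
Proof.
rewrite !phase_diag mulr_suml; apply: eq_bigr => a _.
rewrite mulr_sumr (bigD1 a)//= big1 ?addr0 => [|b ba].
  by rewrite -(diagM he) -!mulrA [diag _ _ * (_ * _)]mulrA -(unit_diagC he) !mulrA (unitsM he) eqxx.
by rewrite -!mulrA [diag _ _ * (_ * _)]mulrA -(unit_diagC he) !mulrA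
  (unitsM he) eq_sym (negbTE ba) !mul0r.
Qed.

Lemma phase_l n (f : G -> R[i]) : phase n (fun a _ => f a) = diag n f.
Proof.
rewrite phase_diag; apply: eq_bigr => a _.
by rewrite (diag_cst he) -scalerAr mulr1.
Qed.

Lemma phase_r n (f : G -> R[i]) : phase n (fun _ b => f b) = diag n.+1 f.
Proof. by rewrite phase_diag -mulr_suml (units1 he) mul1r. Qed.

Lemma eq_phase n phi psi : (forall a b, phi a b = psi a b) -> phase n phi = phase n psi.
Proof. by move=> h; congr phase; apply/funext => a; apply/funext => b. Qed.

Lemma phase_comm n phi x : (forall a, e n a a * x = x * e n a a) ->
  (forall a, e n.+1 a a * x = x * e n.+1 a a) -> phase n phi * x = x * phase n phi.
Proof.
move=> ex ex'; rewrite phase_diag mulr_suml mulr_sumr; apply: eq_bigr => a _.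
by rewrite -mulrA (diag_comm _ ex') mulrA ex mulrA.
Qed.

Lemma diag_phaseC i f n phi : diag i f * phase n phi = phase n phi * diag i f.
Proof. by rewrite phase_comm// => a; rewrite (unit_diagC he). Qed.

Lemma phase_star n phi : star (phase n phi) = phase n (fun a b => (phi a b)^*).
Proof.
rewrite !phase_diag star_sum; apply: eq_bigr => a _.
by rewrite starM (diag_star he) (units_star he) (unit_diagC he).
Qed.

Lemma phase_unitary n phi : (forall a b, `|phi a b| = 1) -> unitary (phase n phi).
Proof.
move=> p1; rewrite /unitary phase_star !phaseM.
have e1 a b : (phi a b)^* * phi a b = 1 by rewrite mul_conjC_unit.
have e2 a b : phi a b * (phi a b)^* = 1 by rewrite mulrC e1.
by rewrite (eq_phase _ e1) (eq_phase _ e2) phase_r (diag_cst he) scale1r.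
Qed.

Definition translates i h W := forall a, e i (h * a)%g (h * a)%g * W = W * e i a a.

Lemma translates_diag i h W f : translates i h W ->
  diag i f * W = W * diag i (fun a => f (h * a)%g).
Proof.
move=> tW; rewrite /diag mulr_suml mulr_sumr [LHS](reindex_inj (mulgI h)) /=.
by apply: eq_bigr => a _; rewrite -scalerAl -scalerAr tW.
Qed.

Lemma translates_phase n h W phi : translates n h W -> translates n.+1 h W ->
  phase n phi * W = W * phase n (fun a b => phi (h * a)%g (h * b)%g).
Proof.
move=> tW tW'; rewrite !phase_diag mulr_suml mulr_sumr [LHS](reindex_inj (mulgI h)) /=.
by apply: eq_bigr => a _; rewrite -mulrA (translates_diag _ tW') mulrA tW mulrA.
Qed.

Lemma regular_translates i h : translates i h (regular i h).
Proof. by move=> a; rewrite unit_regular regular_unit. Qed.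

Lemma translatesM_comm i h W W' : translates i h W ->
  (forall a, e i a a * W' = W' * e i a a) -> translates i h (W * W').
Proof. by move=> tW cW' a; rewrite mulrA tW -!mulrA cW'. Qed.

Lemma translates_commM i h W W' : (forall a, e i a a * W = W * e i a a) ->
  translates i h W' -> translates i h (W * W').
Proof. by move=> cW tW' a; rewrite mulrA cW -!mulrA tW'. Qed.

Variable omega : G -> G -> G -> R[i].
Hypothesis homega : cocycle3 omega.

(** The phase by which left translation by [g] of a word differs from the
    associativity constraint of the pointed fusion category with associator
    [omega], at two consecutive letters. *)
Definition associator g a b : R[i] := omega g a (a^-1 * b)%g.

(** The translation of words of length [n + 1] by [g], multiplied by the phases
    that moving [g] past the brackets of an iterated tensor product produces. The
    factor added at stage [n + 1] commutes with [level n], which is what lets the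
    inner automorphisms converge. *)
Fixpoint implementer n g : A :=
  if n is m.+1 then implementer m g * (regular n g * phase m (associator g))
  else regular 0 g.

Local Notation V := implementer.

Lemma omega1 g h k : `|omega g h k| = 1.
Proof. by case: homega. Qed.

Lemma implementer_unitary n g : unitary (V n g).
Proof.
elim: n => [|n ih]; first exact: regular_unitary.
apply: unitaryM ih _; apply: unitaryM; first exact: regular_unitary.
by apply: phase_unitary => a b; exact: omega1.
Qed.

Lemma implementer_comm n g i a b : (n < i)%N -> e i a b * V n g = V n g * e i a b.
Proof.
have lt_neq (p q : nat) : (p < q)%N -> q <> p by move=> pq E; rewrite E ltnn in pq.
elim: n => [|n ih] ni /=.
  by rewrite regular_comm// => c d; rewrite (unitsC he)//; exact/nesym/lt_neq.
have ni' := ltn_trans (ltnSn n) ni.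
rewrite mulrA ih// -!mulrA; congr (_ * _).
rewrite mulrA -regular_comm; last by move=> c d; rewrite (unitsC he)//; exact/nesym/lt_neq.
rewrite -!mulrA; congr (_ * _); rewrite phase_comm// => c.
  by rewrite (unitsC he)//; exact/nesym/lt_neq.
by rewrite (unitsC he)//; exact/nesym/lt_neq.
Qed.

Lemma implementer_translates n i g : (i <= n)%N -> translates i g (V n g).
Proof.
elim: n => [|n ih] in_; first by move: in_; rewrite leqn0 => /eqP ->; exact: regular_translates.
have pc a : e i a a * phase n (associator g) = phase n (associator g) * e i a a.
  by rewrite phase_comm// => b; exact: unit_unitC.
move: in_; rewrite leq_eqVlt => /orP[/eqP iE|in_] /=.
  apply: translates_commM; first by move=> a; rewrite implementer_comm// iE.
  by apply: translatesM_comm => //; rewrite iE; exact: regular_translates.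
apply: translatesM_comm => [|a]; first exact: ih.
rewrite mulrA -regular_comm => [|c d]; first by rewrite -!mulrA pc.
by rewrite (unitsC he)// => E; rewrite E ltnn in in_.
Qed.

(** Comparing with [associator], the cocycle identity turns the phases of a
    product of two implementing unitaries into a telescoping product, of which
    only the contributions of the first and of the last letter remain. *)
Lemma associator_cocycle g h a b :
  omega g h a * (associator g (h * a)%g (h * b)%g * associator h a b) =
  associator (g * h)%g a b * omega g h b.
Proof.
rewrite /associator invMg -mulgA mulKg.
have := homega.2 g h a (a^-1 * b)%g; rewrite mulKVg => <-.
by rewrite mulrC; congr (_ * _); exact: mulrC.
Qed.

(** By induction: the phases at the letters [n] and [n + 1] transfer the factor
    [omega g h] from the former to the latter. As the factor at the last letter
    commutes with [level n], only that at the first letter is left in the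
    cocycle of the action, and it does not depend on [n]. *)
Lemma implementerM n g h : V n g * V n h =
  V n (g * h)%g * diag 0 (fun a => (omega g h a)^*) * diag n (omega g h).
Proof.
elim: n => [|n ih].
  rewrite /= regularM -mulrA (diagM he).
  rewrite (@eq_diag _ _ _ e 0 _ (fun=> 1)) ?(diag_cst he) ?scale1r ?mulr1// => a.
  by rewrite mul_conjC_unit// omega1.
have Vh : regular n.+1 g * V n h = V n h * regular n.+1 g.
  by rewrite regular_comm// => a b; rewrite implementer_comm.
have diag_reg (i : nat) f k : (i <= n)%N -> diag i f * regular n.+1 k = regular n.+1 k * diag i f.
  move=> in_; rewrite [LHS]diag_comm// => a.
  by rewrite regular_comm// => c d; rewrite (unitsC he)// => E; rewrite -E ltnn in in_.
have tW : translates n h (V n h * regular n.+1 h).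
  apply: translatesM_comm => [|a]; first exact: implementer_translates.
  by rewrite regular_comm// => c d; rewrite (unitsC he)// => /esym/n_Sn.
have tW' : translates n.+1 h (V n h * regular n.+1 h).
  apply: translates_commM (regular_translates _ _) => a.
  by rewrite implementer_comm.
transitivity (V n g * V n h * (regular n.+1 g * regular n.+1 h) *
  (phase n (fun a b => associator g (h * a)%g (h * b)%g) * phase n (associator h))).
  transitivity (V n g * regular n.+1 g *
    (phase n (associator g) * (V n h * regular n.+1 h)) * phase n (associator h)).
    by rewrite /= !mulrA.
  rewrite (translates_phase _ tW tW') -!mulrA; congr (_ * _).
  by rewrite mulrA Vh -!mulrA.
rewrite ih regularM phaseM /= -!mulrA; congr (_ * _).
rewrite [diag n _ * _]mulrA diag_reg// -[_ * diag n _ * _]mulrA.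
rewrite mulrA diag_reg// -!mulrA; congr (_ * _).
rewrite [RHS]mulrA -diag_phaseC -mulrA; congr (_ * _).
rewrite -phase_l -phase_r !phaseM; apply: eq_phase => a b.
exact: associator_cocycle.
Qed.

(** The factor at the first letter in [implementerM], moved to the left of the
    translation by [g * h]. *)
Definition action_cocycle g h : A :=
  diag 0 (fun a => (omega g h ((g * h)^-1 * a)%g)^*).

Lemma action_cocycle_unitary g h : unitary (action_cocycle g h).
Proof. by apply: (diag_unitary he) => a; rewrite norm_conjC omega1. Qed.

Lemma diag_implementer n g i f : (i <= n)%N ->
  diag i f * V n g = V n g * diag i (fun a => f (g * a)%g).
Proof. by move=> in_; apply: translates_diag; exact: implementer_translates. Qed.

Lemma Ad_implementer_diag n g i f : (i <= n)%N ->
  Ad (V n g) (diag i f) = diag i (fun a => f (g^-1 * a)%g).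
Proof.
move=> in_; rewrite /Ad -[in LHS](@eq_diag _ _ _ _ _ (fun a => f (g^-1 * (g * a))%g)); last first.
  by move=> a; rewrite mulKg.
rewrite -(diag_implementer g (fun a => f (g^-1 * a)%g) in_) -mulrA.
by rewrite (implementer_unitary n g).2 mulr1.
Qed.

Lemma implementerM_cocycle n g h : V n g * V n h =
  action_cocycle g h * V n (g * h)%g * diag n (omega g h).
Proof.
rewrite implementerM diag_implementer//; congr (_ * _ * _).
by apply: eq_diag => a; rewrite mulKg.
Qed.

Lemma level_Ad_diag n f x : (forall a, `|f a| = 1) -> level n x -> Ad (diag n f) x = x.
Proof.
move=> f1 hx; apply: Ad_comm; first exact: (diag_unitary he).
by apply: diag_comm => a; rewrite (level_diag_comm a hx).
Qed.

Lemma head_implementer n g : head_factors n.+1 (V n g).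
Proof.
have hS m := (head_closed he m).1.
have reg m : head_factors m.+1 (regular m g).
  by apply: (star_subalgebra_sum (hS _)) => a _; exact: head_unit.
elim: n => [|n ih]; first exact: reg.
apply: (star_subalgebraM (hS _) (headS he ih)).
apply: (star_subalgebraM (hS _)); first exact: reg.
apply: (star_subalgebra_sum (hS _)) => a _; apply: (star_subalgebra_sum (hS _)) => b _.
apply: (star_subalgebraZ (hS _)); apply: (star_subalgebraM (hS _)).
  by apply: headS => //; exact: head_unit.
exact: head_unit.
Qed.

Lemma level_Ad_implementer n g x : level n x -> level n (Ad (V n g) x).
Proof.
move=> hx; have hS := (head_closed he n.+1).1; have hV := head_implementer n g.
split.
  apply: (star_subalgebraM hS); last exact: (star_subalgebra_star hS).
  by apply: (star_subalgebraM hS) => //; case: hx.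
(* [x] commutes with the projection at [g^-1 * a], of which [e n a a] is the
   image under conjugation by the implementing unitary. *)
move=> _ [a _ <-]; pose f c : R[i] := (c == a)%:R.
rewrite unit_as_diag -/f.
rewrite -[f](_ : (fun c => f (g * (g^-1 * c))%g) = f); last first.
  by apply/funext => c; rewrite mulKVg.
rewrite -(Ad_implementer_diag g (fun c => f (g * c)%g) (leqnn n)).
have hAd := Ad_star_hom (implementer_unitary n g).
rewrite -!(star_homM hAd); congr Ad; apply/esym.
by apply: diag_comm => c; rewrite (level_diag_comm c hx).
Qed.

Lemma Ad_implementer_stable n m g x : level n x -> (n <= m)%N ->
  Ad (V m g) x = Ad (V n g) x.
Proof.
move=> hx /subnK <-; elim: (m - n)%N => // k ih.
rewrite addSn -ih /= AdM; congr Ad; apply: Ad_comm.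
  apply: unitaryM; first exact: regular_unitary.
  by apply: phase_unitary => a b; exact: omega1.
have kn : (n < (k + n).+1)%N by rewrite ltnS leq_addl.
have xk a : x * e (k + n) a a = e (k + n) a a * x.
  have [k0|k0] := posnP k; first by rewrite k0; exact: (level_diag_comm a hx).
  by apply: (level_head_comm he _ _ hx); rewrite -[X in (X < _)%N]add0n ltn_add2r.
have xk1 a b : e (k + n).+1 a b * x = x * e (k + n).+1 a b.
  by rewrite (level_head_comm he a b hx).
by rewrite -mulrA phase_comm// mulrA regular_comm// mulrA.
Qed.

End Implementing.

(** * Unions of subalgebras as inductive limits *)

Section InductiveLimit.
Variable R : realType.

(** The domain of the closure of [Gr] is a closed subalgebra: if [x] is a limit
    of points of the domain, approximate these by points on the graph itself, whose
    values are then a Cauchy sequence because the graph is bounded. *)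
Lemma star_hom_extension (A D : cstarType R) (Gr : A -> D -> Prop) :
  Gr 1 1 ->
  (forall a x d y d', Gr x d -> Gr y d' -> Gr (a *: x + y) (a *: d + d')) ->
  (forall x d y d', Gr x d -> Gr y d' -> Gr (x * y) (d * d')) ->
  (forall x d, Gr x d -> Gr (star x) (star d)) ->
  (forall x d, Gr x d -> cnorm d <= 2 * cnorm x) ->
  (forall S, closed_star_subalgebra S -> (forall x d, Gr x d -> S x) -> S = setT) ->
  exists f : A -> D, star_hom f /\ forall x d, Gr x d -> f x = d.
Proof.
move=> Gr1 GrP GrM Grs Grb Grd.
pose cl x d := exists (y : nat -> A) (z : nat -> D),
  [/\ forall n, Gr (y n) (z n), tends y x & tends z d].
have clGr x d : Gr x d -> cl x d.
  by move=> h; exists (fun=> x), (fun=> d); split => //; exact: (@tends_near _ _ _ _ 0%N).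
have clP a x d y d' : cl x d -> cl y d' -> cl (a *: x + y) (a *: d + d').
  move=> [p [q [pq px qd]]] [p' [q' [pq' px' qd']]].
  exists (fun n => a *: p n + p' n), (fun n => a *: q n + q' n).
  by split=> [n||]; [exact: GrP|apply: tendsD => //; exact: tendsZ|
    apply: tendsD => //; exact: tendsZ].
have clM x d y d' : cl x d -> cl y d' -> cl (x * y) (d * d').
  move=> [p [q [pq px qd]]] [p' [q' [pq' px' qd']]].
  exists (fun n => p n * p' n), (fun n => q n * q' n).
  by split=> [n||]; [exact: GrM|exact: tendsM|exact: tendsM].
have cls x d : cl x d -> cl (star x) (star d).
  move=> [p [q [pq px qd]]]; exists (fun n => star (p n)), (fun n => star (q n)).
  by split=> [n||]; [exact: Grs|exact: tends_star|exact: tends_star].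
have GrB x d y d' : Gr x d -> Gr y d' -> cnorm (d - d') <= 2 * cnorm (x - y).
  move=> h h'; apply: Grb; have := GrP (-1) y d' x d h' h.
  by rewrite !scaleN1r ![- _ + _]addrC.
have clU x d d' : cl x d -> cl x d' -> d = d'.
  move=> [p [q [pq px qd]]] [p' [q' [pq' px' qd']]].
  apply: tends_unique qd _.
  have h : null_seq (fun n => p n - p' n).
    have := null_seqD px (null_seqN px'); apply: null_seq_ext => n.
    by rewrite opprB addrA subrK.
  have {}h : null_seq (fun n => q n - q' n) by apply: null_seq_scale h => n; exact: GrB.
  by have := null_seqD h qd'; apply: null_seq_ext => n; rewrite addrA subrK.
have clT : [set x | exists d, cl x d] = setT.
  apply: Grd => [|x d h]; last by exists d; exact: clGr.
  split; first split => /=.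
  - by exists 1; exact: clGr.
  - by move=> a x y [d h] [d' h']; exists (a *: d + d'); exact: clP.
  - by move=> x y [d h] [d' h']; exists (d * d'); exact: clM.
  - by move=> x [d h]; exists (star d); exact: cls.
  - move=> x l hx xl.
    have /choice[p hp] : forall n, exists p : A * D,
        Gr p.1 p.2 /\ cnorm (p.1 - x n) < n.+1%:R^-1.
      move=> n; have [d [y [z [yz yx _]]]] := hx n.
      have n0 : 0 < n.+1%:R^-1 :> R by rewrite invr_gt0.
      have [N /(_ N (leqnn _)) hN] := (null_seqP _).1 yx _ n0.
      by exists (y N, z N); split; [exact: yz|exact: hN].
    have pl : tends (fun n => (p n).1) l.
      have h : null_seq (fun n => (p n).1 - x n).
        apply: (@null_seq_le _ _ (fun n => n.+1%:R^-1)) => [|n]; first exact: cvg_harmonic.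
        exact: ltW (hp n).2.
      by have := null_seqD h xl; apply: null_seq_ext => n; rewrite addrA subrK.
    have [r r0|d hd] := @cnorm_complete _ D (fun n => (p n).2).
      have [|N hN] := (null_seqP _).1 pl (r / 4); first by rewrite divr_gt0.
      exists N => m n Nm Nn; apply: le_lt_trans (GrB _ _ _ _ (hp m).1 (hp n).1) _.
      have := cnormB ((p m).1 - l) ((p n).1 - l); rewrite opprB addrA subrK.
      have := hN m Nm; have := hN n Nn; lra.
    by exists d, (fun n => (p n).1), (fun n => (p n).2); split => // n; exact: (hp n).1.
have /choice[f hf] : forall x, exists d, cl x d.
  by move=> x; have : [set x | exists d, cl x d] x by rewrite clT.
exists f; split; last by move=> x d /clGr; exact: clU.
split.
- by move=> a x y; apply: clU (hf _) _; exact: clP.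
- by move=> x y; apply: clU (hf _) _; exact: clM.
- by apply: clU (hf _) _; exact: clGr.
- by move=> x; apply: clU (hf _) _; exact: cls.
Qed.

Variables (A : cstarType R) (S : nat -> cstar_sub A).
Hypothesis S_mono : forall n x, cstar_sub_set (S n) x -> cstar_sub_set (S n.+1) x.
Hypothesis S_dense : forall T, closed_star_subalgebra T ->
  (forall n x, cstar_sub_set (S n) x -> T x) -> T = setT.

Definition sub_incl n (x : cstar_sub_type (S n)) : cstar_sub_type (S n.+1) :=
  cstar_in (S_mono (cstar_valP x)).

Lemma sub_incl_hom n : star_hom (@sub_incl n).
Proof. by split=> [a x y|x y||x]; apply: cstar_val_inj. Qed.

(** The given homomorphisms agree on the union of the subalgebras and are bounded
    with a common constant, hence extend to the closure. The extension is unique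
    among all *-homomorphisms because these are continuous. *)
Lemma union_inductive_limit :
  inductive_limit sub_incl (fun n => @cstar_val R A (S n)).
Proof.
split=> [n|n x|D psi hpsi psiC]; [exact: cstar_val_hom|by []|].
have bump k n (x : cstar_sub_type (S n)) : exists y : cstar_sub_type (S (k + n)),
    cstar_val y = cstar_val x /\ psi _ y = psi n x.
  elim: k => [|k [y [yx py]]]; first by exists x.
  by exists (sub_incl y); rewrite psiC.
pose Gr (x : A) (d : D) := exists n (y : cstar_sub_type (S n)),
  cstar_val y = x /\ psi n y = d.
have common x d y d' : Gr x d -> Gr y d' -> exists n (p q : cstar_sub_type (S n)),
    [/\ cstar_val p = x, psi n p = d, cstar_val q = y & psi n q = d'].
  move=> [n [p [<- <-]]] [m [q [<- <-]]].
  have [p' [h1 h2]] := bump m n p; have := bump n m q.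
  rewrite addnC => -[q' [h3 h4]].
  by exists (m + n)%N, p', q'.
have [||||||f [hf ef]] := @star_hom_extension A D Gr.
- by exists 0%N, 1; split => //; exact: star_hom1.
- move=> a x d y d' h h'; have [n [p [q [<- <- <- <-]]]] := common _ _ _ _ h h'.
  by exists n, (a *: p + q); rewrite (star_hom_linear (hpsi n)).
- move=> x d y d' h h'; have [n [p [q [<- <- <- <-]]]] := common _ _ _ _ h h'.
  by exists n, (p * q); rewrite (star_homM (hpsi n)).
- move=> x d [n [p [<- <-]]].
  by exists n, (star p); rewrite (star_hom_star (hpsi n)).
- by move=> x d [n [p [<- <-]]]; exact: (star_hom_cnorm_le (hpsi n) p).
- move=> T hT TGr; apply: S_dense => // n x Sx.
  by apply: (TGr x (psi n (cstar_in Sx))); exists n, (cstar_in Sx).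
exists f; split; first by split=> // n x; apply: (ef _ (psi n x)); exists n, x.
move=> f' [hf' ef']; apply/funext => x.
have E : [set x | f x = f' x] = setT.
  apply: S_dense => [|n y Sy]; first exact: closed_star_equalizer.
  by rewrite /= -(cstar_inK Sy) ef'; apply: (ef _ (psi n (cstar_in Sy))); exists n, (cstar_in Sy).
by have : [set x | f x = f' x] x by rewrite E.
Qed.
End InductiveLimit.

(** * The limit action *)

Section FromCocycle.
Variables (R : realType) (G : finGroupType) (omega : G -> G -> G -> R[i]).
Hypothesis omega1 : forall g h k, `|omega g h k| = 1.
Variables (A : cstarType R) (alpha : G -> A -> A) (u : G -> G -> A) (w : A).

(** Bijectivity is automatic: [alpha g] has both a left and a right inverse,
    since [alpha a] followed by [alpha b] is inner when [a] and [b] are inverse to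
    each other. *)
Lemma omega_action_intro :
  (forall g, star_hom (alpha g)) ->
  (forall g h, unitary (u g h)) ->
  (forall g h x, alpha g (alpha h x) = Ad (u g h) (alpha (g * h)%g x)) ->
  unitary w -> (forall x, alpha 1%g x = Ad w x) ->
  (forall g h k, anomaly_element alpha u g h k = omega g h k *: 1) ->
  omega_action omega alpha u.
Proof.
move=> ha hu hc hw h1 hanom; split => //; split => //; last first.
  by move=> g h k; exists (omega g h k).
move=> g; split; first exact: ha.
have AdK v x : unitary v -> Ad (star v) (Ad v x) = x.
  by move=> [hv _]; rewrite -AdM hv /Ad star1 mulr1 mul1r.
have AdKV v x : unitary v -> Ad v (Ad (star v) x) = x.
  by move=> [_ hv]; rewrite -AdM hv /Ad star1 mulr1 mul1r.
have inv a b x : (a * b = 1)%g -> alpha a (alpha b x) = Ad (u a b * w) x.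
  by move=> ab; rewrite hc ab h1 AdM.
pose r x := alpha g^-1%g (Ad (star (u g g^-1%g * w)) x).
pose l x := Ad (star (u g^-1%g g * w)) (alpha g^-1%g x).
have uw a b : unitary (u a b * w) by exact: unitaryM.
have rK x : alpha g (r x) = x by rewrite /r inv ?mulgV// AdKV.
have lK x : l (alpha g x) = x by rewrite /l inv ?mulVg// AdK.
by exists l => // x; rewrite -{1}(rK x) lK rK.
Qed.

End FromCocycle.

Section LimitAction.
Variables (R : realType) (G : finGroupType) (A : cstarType R) (e : nat -> G -> G -> A).
Hypothesis he : commuting_units e.
Variable omega : G -> G -> G -> R[i].
Hypothesis homega : cocycle3 omega.
Local Notation V := (implementer e omega).
Local Notation u := (action_cocycle e omega).
Local Notation level := (level e).
Implicit Types (g h k : G) (x y : A) (n : nat).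

Let omega1 g h k : `|omega g h k| = 1.
Proof. by case: homega. Qed.

Let AdV_hom n g : star_hom (Ad (V n g)).
Proof. exact/Ad_star_hom/implementer_unitary. Qed.

Lemma Ad_implementer_cvg g x : exists l, tends (fun n => Ad (V n g) x) l.
Proof.
suff : [set x | exists l, tends (fun n => Ad (V n g) x) l] = setT.
  by move=> E; have : [set x | exists l, tends (fun n => Ad (V n g) x) l] x by rewrite E.
apply: (level_dense he) => [|n y hy].
  apply: (@closed_star_convergence _ _ (fun n => Ad (V n g))) => // n y.
  by apply: cnorm_Ad_le; exact: implementer_unitary.
exists (Ad (V n g) y); apply: (@tends_near _ _ _ _ n) => m nm.
exact: Ad_implementer_stable.
Qed.

Definition limit_action g x : A := projT1 (cid (Ad_implementer_cvg g x)).
Local Notation alpha := limit_action.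

Lemma limit_action_tends g x : tends (fun n => Ad (V n g) x) (alpha g x).
Proof. exact: (projT2 (cid (Ad_implementer_cvg g x))). Qed.

Lemma limit_action_level n g x : level n x -> alpha g x = Ad (V n g) x.
Proof.
move=> hx; apply: tends_unique (limit_action_tends g x) _.
by apply: (@tends_near _ _ _ _ n) => m nm; exact: Ad_implementer_stable.
Qed.

Lemma limit_action_hom g : star_hom (alpha g).
Proof.
have tA := limit_action_tends g; split.
- move=> a x y; apply: tends_unique (tA _) _.
  under eq_fun => n do rewrite (star_hom_linear (AdV_hom n g)).
  by apply: tendsD => //; exact: tendsZ.
- move=> x y; apply: tends_unique (tA _) _.
  under eq_fun => n do rewrite (star_homM (AdV_hom n g)).
  exact: tendsM.
- apply: tends_unique (tA _) _.
  by apply: (@tends_near _ _ _ _ 0%N) => n _; exact: star_hom1.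
- move=> x; apply: tends_unique (tA _) _.
  under eq_fun => n do rewrite (star_hom_star (AdV_hom n g)).
  exact: tends_star.
Qed.

Lemma eq_on_levels (B : cstarType R) (f f' : A -> B) : star_hom f -> star_hom f' ->
  (forall n x, level n x -> f x = f' x) -> forall x, f x = f' x.
Proof.
move=> hf hf' ff' x.
have E : [set x | f x = f' x] = setT.
  by apply: (level_dense he) => //; exact: closed_star_equalizer.
by have : [set x | f x = f' x] x by rewrite E.
Qed.

Lemma limit_action_comp g h x : alpha g (alpha h x) = Ad (u g h) (alpha (g * h)%g x).
Proof.
have hu := Ad_star_hom (action_cocycle_unitary he homega g h).
move: x; apply: (eq_on_levels (star_hom_comp (limit_action_hom h) (limit_action_hom g))
  (star_hom_comp (limit_action_hom (g * h)%g) hu)) => n x hx /=.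
rewrite !(limit_action_level _ hx) (limit_action_level (n := n)).
  rewrite -!AdM implementerM_cocycle// AdM (level_Ad_diag he (omega1 g h) hx)//.
exact: level_Ad_implementer.
Qed.

(** For [g = h = 1], cancelling a unitary in [implementerM] shows that the
    implementing unitaries of [1] are diagonal. *)
Lemma limit_action1 x : alpha 1%g x = Ad (u 1%g 1%g) x.
Proof.
have hu := Ad_star_hom (action_cocycle_unitary he homega 1%g 1%g).
move: x; apply: (eq_on_levels (limit_action_hom 1%g) hu) => n x hx.
have [VV _] := implementer_unitary he homega n 1%g.
have -> : u 1%g 1%g = diag e 0 (fun a => (omega 1%g 1%g a)^*).
  by apply: eq_diag => a; rewrite mulg1 invg1 mul1g.
have V1 : V n 1%g = diag e 0 (fun a => (omega 1%g 1%g a)^*) * diag e n (omega 1%g 1%g).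
  rewrite -[LHS]mul1r -VV -mulrA implementerM// mulg1 !mulrA VV mul1r.
  by [].
by rewrite (limit_action_level _ hx) V1 AdM (level_Ad_diag he (omega1 1%g 1%g) hx).
Qed.

Lemma level0 n x : level 0 x -> level n x.
Proof. by move=> hx; elim: n => // n; exact: levelS. Qed.

Lemma action_cocycle_level n g h : level n (u g h).
Proof. by apply: level0; exact: level_diag. Qed.

Lemma limit_action_anomaly g h k : anomaly_element alpha u g h k = omega g h k *: 1.
Proof.
rewrite /anomaly_element (limit_action_level _ (action_cocycle_level 0 h k)).
rewrite /action_cocycle (Ad_implementer_diag he homega)// !(diag_star he) !(diagM he).
rewrite -(diag_cst he 0); apply: eq_diag => y; rewrite !conjCK.
(* The cocycle identity is applied at [g], [h], [k] and this [z]. *)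
have [z ->] : exists z, y = (g * h * k * z)%g.
  by exists ((g * h * k)^-1 * y)%g; rewrite mulKVg.
have -> : ((h * k)^-1 * (g^-1 * (g * h * k * z)) = z)%g.
  by rewrite -!mulgA !mulKg invMg -!mulgA !mulKg.
have -> : ((g * (h * k))^-1 * (g * h * k * z) = z)%g by rewrite -!mulgA !invMg -!mulgA !mulKg.
have -> : ((g * h * k)^-1 * (g * h * k * z) = z)%g by rewrite mulKg.
have -> : ((g * h)^-1 * (g * h * k * z) = k * z)%g by rewrite -!mulgA !invMg -!mulgA !mulKg.
rewrite -mulrA -homega.2.
by rewrite mulrA mulrACA !mul_conjC_unit ?mul1r.
Qed.

Lemma limit_action_level_stable n g x : level n x -> level n (alpha g x).
Proof. by move=> hx; rewrite (limit_action_level _ hx); exact: level_Ad_implementer. Qed.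

Lemma limit_omega_action : omega_action omega alpha u.
Proof.
apply: (omega_action_intro omega1 limit_action_hom _ limit_action_comp
  (action_cocycle_unitary he homega 1%g 1%g) limit_action1 limit_action_anomaly) => g h.
exact: action_cocycle_unitary.
Qed.

Definition level_sub n : cstar_sub A := CstarSub (level_closed he n).
Local Notation L n := (cstar_sub_type (level_sub n)).

Definition level_action n g (x : L n) : L n :=
  cstar_in (S := level_sub n) (limit_action_level_stable g (cstar_valP x)).

Definition level_cocycle n g h : L n :=
  cstar_in (S := level_sub n) (action_cocycle_level n g h).

Lemma level_omega_action n : omega_action omega (@level_action n) (level_cocycle n).
Proof.
have uu g h : unitary (level_cocycle n g h).
  have [h1 h2] := action_cocycle_unitary he homega g h.
  by split; apply: cstar_val_inj.
apply: (omega_action_intro omega1 _ uu _ (uu 1%g 1%g)).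
- have hh g := limit_action_hom g.
  move=> g; split=> [a x y|x y||x]; apply: cstar_val_inj.
  + exact: (star_hom_linear (hh g)).
  + exact: (star_homM (hh g)).
  + exact: (star_hom1 (hh g)).
  + exact: (star_hom_star (hh g)).
- by move=> g h x; apply: cstar_val_inj; exact: limit_action_comp.
- by move=> x; apply: cstar_val_inj; exact: limit_action1.
- by move=> g h k; apply: cstar_val_inj; exact: limit_action_anomaly.
Qed.

Lemma level_finite_dimensional n : finite_dimensional (L n).
Proof.
have [J [v [hv sv]]] := level_spanned he n.
exists #|J|, (fun i => cstar_in (S := level_sub n) (hv (enum_val i))) => x.
have [z xz] := sv _ (cstar_valP x).
exists (fun i => z (enum_val i)); apply: cstar_val_inj; rewrite xz.
rewrite (big_morph (@cstar_val R A (level_sub n)) (id1 := 0) (op1 := +%R))//.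
rewrite [RHS](reindex enum_rank) /=; last first.
  by exists enum_val => ? _; [exact: enum_rankK|exact: enum_valK].
by apply: eq_bigr => j _; rewrite enum_rankK.
Qed.

(** The subalgebras [level n] are invariant and contain the values of the cocycle,
    so the action is the inductive limit of its restrictions, and the cocycle
    conjugacy is the identity. *)
Lemma limit_AF_action : AF_action omega alpha u.
Proof.
split; first exact: limit_omega_action.
pose mono n x : cstar_sub_set (level_sub n) x -> cstar_sub_set (level_sub n.+1) x :=
  @levelS _ _ _ _ he n x.
exists (fun n => L n), level_action, level_cocycle, (sub_incl mono), A,
  (fun n => @cstar_val R A (level_sub n)), alpha, u; split.
  split=> //.
  - exact: level_finite_dimensional.
  - exact: level_omega_action.
  - exact: sub_incl_hom.
  - by move=> n g x; apply: cstar_val_inj.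
  - by move=> n g h; apply: cstar_val_inj.
  - by apply: union_inductive_limit => T hT TL; exact: (level_dense he).
  - exact: limit_omega_action.
exists id, (fun=> 1); split.
- by split; [exact: star_hom_id|exists id].
- by move=> g; exact: unitary1.
- by move=> g x; rewrite /Ad star1 mul1r mulr1.
- by move=> g h; rewrite (star_hom1 (limit_action_hom g)) star1 !mul1r mulr1.
Qed.

Lemma unit_norm_le1 n g : cnorm (e n g g) <= 1.
Proof.
have := cnorm_star (e n g g); rewrite (units_star he) (unitsM he) eqxx => h.
have [//|h1] := leP (cnorm (e n g g)) 1.
by move: h; have := cnorm_ge0 (e n g g); nra.
Qed.

Lemma unit_asymptotically_central g x :
  null_seq (fun n => e n g g * x - x * e n g g).
Proof.
pose S : set A := [set y | null_seq (fun n => e n g g * y - y * e n g g)].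
suff E : S = setT by have : S x by rewrite E.
apply: (level_dense he) => [|m y hy]; last first.
  apply: (@null_seq_near _ _ _ m) => n; rewrite leq_eqVlt => /orP[/eqP <-|mn].
    by rewrite (level_diag_comm g hy) subrr.
  by rewrite (level_head_comm he g g hy mn) subrr.
split; first split.
- by apply: (@null_seq_near _ _ _ 0%N) => n _; rewrite mulr1 mul1r subrr.
- move=> a y z Sy Sz; apply: null_seq_ext (null_seqD (null_seqZ a Sy) Sz) => n /=.
  by rewrite mulrDr mulrDl -scalerAr -scalerAl scalerBr opprD addrACA.
- move=> y z Sy Sz; apply: null_seq_ext (null_seqD (null_seqMr z Sy) (null_seqMl y Sz)) => n /=.
  by rewrite mulrBl mulrBr !mulrA addrA subrK.
- move=> y Sy; apply: null_seq_ext (null_seqN (null_seq_star Sy)) => n /=.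
  by rewrite starB !starM (units_star he) opprB.
- move=> y l Sy yl; apply/null_seqP => r r0.
  have [|K /(_ K (leqnn _)) hK] := (null_seqP _).1 yl (r / 4); first by rewrite divr_gt0.
  have [|N hN] := (null_seqP _).1 (Sy K) (r / 4); first by rewrite divr_gt0.
  exists N => n /hN {}hN; set p := e n g g in hN *.
  have -> : p * l - l * p = (p * y K - y K * p) - (p * (y K - l) - (y K - l) * p).
    rewrite mulrBr mulrBl; apply/eqP; rewrite eq_sym subr_eq addrACA -opprD.
    by rewrite [p * l + _]addrC [l * p + _]addrC !subrK.
  apply: le_lt_trans (cnormB _ _) _.
  have := cnormB (p * (y K - l)) ((y K - l) * p).
  have := cnormM p (y K - l); have := cnormM (y K - l) p.
  have := unit_norm_le1 n g; rewrite -/p.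
  have := cnorm_ge0 (y K - l); have := cnorm_ge0 p.
  move: hK hN; rewrite /=.
  set c1 := cnorm (y K - l); set c2 := cnorm p; set c3 := cnorm (p * y K - _).
  set c4 := cnorm (p * (y K - l)); set c5 := cnorm ((y K - l) * p); set c6 := cnorm _.
  clearbody c1 c2 c3 c4 c5 c6; nra.
Qed.

Lemma F_eq_refl (x y : nat -> A) : (forall n, x n = y n) -> F_eq x y.
Proof.
move=> xy a; split; apply: (@null_seq_near _ _ _ 0%N) => n _; rewrite xy subrr.
  by rewrite mul0r.
by rewrite mulr0.
Qed.

(** Rokhlin projections: the minimal diagonal projections of the factor [n], for
    [n] going to infinity. They lie in [level n], where the action translates
    them. *)
Lemma limit_action_Rokhlin : Rokhlin_property alpha.
Proof.
exists (fun g n => e n g g); split.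
- move=> g; split; first by exists 1 => n; exact: unit_norm_le1.
  exact: unit_asymptotically_central.
- move=> g; split; apply: F_eq_refl => n; first by rewrite (unitsM he) eqxx.
  exact: units_star.
- by apply: F_eq_refl => n; exact: units1.
- move=> g h; apply: F_eq_refl => n; rewrite !unit_as_diag.
  rewrite (limit_action_level _ (level_diag he n _)) (Ad_implementer_diag he homega)//.
  apply: eq_diag => a; congr (_%:R).
  by rewrite (can2_eq (mulKVg g) (mulKg g)).
Qed.

End LimitAction.

(* The UHF algebra exists, and each of its (mutually isomorphic) realizations
   carries the required action. *)
Theorem proposition5p1 (R : realType) (G : finGroupType)
    (omega : G -> G -> G -> R[i]) (omega_cocycle : cocycle3 omega) :
  (exists A : cstarType R, is_UHF_infty #|G| A) /\
  (forall A : cstarType R, is_UHF_infty #|G| A ->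
    exists (alpha : G -> A -> A) (u : G -> G -> A),
      AF_action omega alpha u /\ Rokhlin_property alpha).
Proof.
split=> [|A /UHF_commuting_units[e he]]; first exact: UHF_exists.
exists (limit_action he omega_cocycle), (action_cocycle e omega); split.
  exact: limit_AF_action.
exact: limit_action_Rokhlin.
Qed.
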